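(* Let $p\ge 5$ and $N\ge 5$ be prime numbers with $N\equiv 1\pmod p$, and let $\nu$ be the $p$-adic valuation of $N-1$. Suppose that there is $u\in\mathbf{Z}[\zeta_p]$ with $N=\mathrm{N}_{\mathbf{Q}(\zeta_p)/\mathbf{Q}}(u)$. Let $\chi:(\mathbf{Z}/p\mathbf{Z})^\times\to\mathbf{Z}_p^\times$ be an odd character ($\chi(-1)=-1$), $\chi\neq\omega$, such that $B_{1,\chi^{-1}}:=\frac1p\sum_{a=1}^{p-1}a\cdot\chi^{-1}(a)$ lies in $\mathbf{Z}_p^\times$. Then $$\sum_{a=2}^{p-1}(\chi^{-1}(a)-1)\cdot\log(\sigma_a(u))\equiv\frac{1}{B_{1,\chi^{-1}}}\cdot\left(\sum_{k=1}^{N-1}\Big(\sum_{a=1}^{k-1}\chi^{-1}(a)\Big)\cdot\log(k)\right)\pmod{p^\nu}.$$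
   Context: $\log:(\mathbf{Z}/N\mathbf{Z})^\times\to\mathbf{Z}/p^\nu\mathbf{Z}$ is a fixed surjective group homomorphism. $\zeta_p$ is a primitive $p$-th root of unity and $\sigma_a\in\mathrm{Gal}(\mathbf{Q}(\zeta_p)/\mathbf{Q})$ is given by $\sigma_a(\zeta_p)=\zeta_p^a$. $\omega:(\mathbf{Z}/p\mathbf{Z})^\times\to\mathbf{Z}_p^\times$ is the Teichmüller character ($\omega(a)\equiv a\bmod p$). In sums over integers $a$, $\chi^{-1}(a)$ means $\chi^{-1}(a\bmod p)$, with value $0$ if $p\mid a$. Since $N\equiv1\pmod p$, $(u)$ is a prime ideal above $N$, the residue ring $\mathbf{Z}[\zeta_p]/(u)$ is canonically $\mathbf{F}_N$, and for $a\not\equiv1\pmod p$ the element $\sigma_a(u)$ is prime to $(u)$; $\log(\sigma_a(u))$ denotes $\log$ of the class of $\sigma_a(u)$ in $(\mathbf{Z}[\zeta_p]/(u))^\times=\mathbf{F}_N^\times$. *)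

(* Defs.v *)
From HB Require Import structures.
From mathcomp Require Import all_boot all_order all_fingroup all_algebra all_field.
From mathcomp Require Import boolp.

Set Implicit Arguments.
Unset Strict Implicit.
Unset Printing Implicit Defensive.

Import GRing.Theory.
Local Open Scope ring_scope.

(* Z_p as the inverse limit of the rings Z/p^(n+1)Z, n >= 0; the exponent is
   shifted because 'Z_1 is not the zero ring. *)

Definition padic_compat (p : nat) (x : forall n, 'Z_(p ^ n.+1)) : Prop :=
  forall n, (x n.+1 : nat)%:R = x n.

(* The primality proof is a parameter so that the integral domain structure
   below can be inferred. *)
Record padic_int (p : nat) (p_pr : prime p) := PadicInt {
  padic_coord :> forall n, 'Z_(p ^ n.+1);
  _ : `[< padic_compat padic_coord >] }.

Section PadicIntegers.
Variables (p : nat) (p_pr : prime p).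
Local Notation padic_int := (padic_int p_pr).

HB.instance Definition _ := [isSub for @padic_coord p p_pr].
HB.instance Definition _ := [Choice of padic_int by <:].

Lemma padic_gt1 n : (1 < p ^ n.+1)%N.
Proof. by rewrite -(exp1n n.+1) ltn_exp2r // prime_gt1. Qed.

Lemma padic_coordP (x : padic_int) n : (x n.+1 : nat)%:R = x n.
Proof. by move: n; apply/asboolP; case: x. Qed.

Lemma padic_eqP (x y : padic_int) : (forall n, x n = y n) -> x = y.
Proof. move=> e; apply: val_inj => /=. exact: functional_extensionality_dep. Qed.

Lemma padic_natr0 n j k :
  j%:R = k%:R :> 'Z_(p ^ n.+2) -> j%:R = k%:R :> 'Z_(p ^ n.+1).
Proof.
move=> /(congr1 (@nat_of_ord _)); rewrite !val_Zp_nat ?padic_gt1 // => e.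
apply: ord_inj; rewrite !val_Zp_nat ?padic_gt1 //.
have dv : (p ^ n.+1 %| p ^ n.+2)%N by rewrite dvdn_exp2l.
by rewrite -(modn_dvdm j dv) e modn_dvdm.
Qed.

Lemma padic_natr n k (a : 'Z_(p ^ n.+2)) :
  a = k%:R -> (a : nat)%:R = k%:R :> 'Z_(p ^ n.+1).
Proof. by move=> e; apply: padic_natr0; rewrite natr_Zp. Qed.

Lemma padic_natz n (a : 'Z_(p ^ n.+1)) : a = (a : nat)%:R.
Proof. by rewrite natr_Zp. Qed.

Definition padic_mk (f : forall n, 'Z_(p ^ n.+1)) (cf : padic_compat f) : padic_int :=
  @PadicInt p p_pr f (introT (asboolP _) cf).

Fact padic_zero_subproof : @padic_compat p (fun _ => 0).
Proof. by []. Qed.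
Fact padic_one_subproof : @padic_compat p (fun _ => 1).
Proof. by move=> n; rewrite (@padic_natr _ 1). Qed.
Fact padic_add_subproof (x y : padic_int) : @padic_compat p (fun n => x n + y n).
Proof.
move=> n; rewrite (@padic_natr _ (x n.+1 + y n.+1)); last first.
  by rewrite natrD -!padic_natz.
by rewrite natrD !padic_coordP.
Qed.
Fact padic_mul_subproof (x y : padic_int) : @padic_compat p (fun n => x n * y n).
Proof.
move=> n; rewrite (@padic_natr _ (x n.+1 * y n.+1)); last first.
  by rewrite natrM -!padic_natz.
by rewrite natrM !padic_coordP.
Qed.
Fact padic_opp_subproof (x : padic_int) : @padic_compat p (fun n => - x n).
Proof.
move=> n; apply: (addrI (x n)); rewrite subrr -{1}padic_coordP -natrD.
by rewrite -(@padic_natr _ _ 0) // natrD -!padic_natz subrr.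
Qed.

Definition padic_zero := padic_mk padic_zero_subproof.
Definition padic_one := padic_mk padic_one_subproof.
Definition padic_add x y := padic_mk (padic_add_subproof x y).
Definition padic_mul x y := padic_mk (padic_mul_subproof x y).
Definition padic_opp x := padic_mk (padic_opp_subproof x).

Fact padic_addA : associative padic_add.
Proof. by move=> x y z; apply: padic_eqP => n /=; rewrite addrA. Qed.
Fact padic_addC : commutative padic_add.
Proof. by move=> x y; apply: padic_eqP => n /=; rewrite addrC. Qed.
Fact padic_add0 : left_id padic_zero padic_add.
Proof. by move=> x; apply: padic_eqP => n /=; rewrite add0r. Qed.
Fact padic_addN : left_inverse padic_zero padic_opp padic_add.
Proof. by move=> x; apply: padic_eqP => n /=; rewrite addNr. Qed.

HB.instance Definition _ := GRing.isZmodule.Build padic_int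
  padic_addA padic_addC padic_add0 padic_addN.

Fact padic_mulA : associative padic_mul.
Proof. by move=> x y z; apply: padic_eqP => n /=; rewrite mulrA. Qed.
Fact padic_mulC : commutative padic_mul.
Proof. by move=> x y; apply: padic_eqP => n /=; rewrite mulrC. Qed.
Fact padic_mul1 : left_id padic_one padic_mul.
Proof. by move=> x; apply: padic_eqP => n /=; rewrite mul1r. Qed.
Fact padic_mulDl : left_distributive padic_mul +%R.
Proof. by move=> x y z; apply: padic_eqP => n /=; rewrite mulrDl. Qed.
Fact padic_one_neq0 : padic_one != 0.
Proof. by apply/eqP => /(congr1 (fun x : padic_int => x 0)) /eqP; rewrite oner_eq0. Qed.

HB.instance Definition _ := GRing.Zmodule_isComNzRing.Build padic_int
  padic_mulA padic_mulC padic_mul1 padic_mulDl padic_one_neq0.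

Definition padic_unit : {pred padic_int} :=
  fun x => `[< forall n, x n \is a GRing.unit >].

Fact padic_inv_subproof (x : padic_int) :
  @padic_compat p (fun n => if x \in padic_unit then (x n)^-1 else x n).
Proof.
case xu: (x \in padic_unit) => n; last exact: padic_coordP.
have ux m : x m \is a GRing.unit by move/asboolP: xu.
have h : (x n.+1 : nat)%:R * (((x n.+1)^-1)%R : nat)%:R = 1 :> 'Z_(p ^ n.+1).
  rewrite -natrM; apply: (@padic_natr0 _ _ 1).
  by rewrite natrM !natr_Zp (divrr (ux n.+1)).
rewrite padic_coordP in h.
by apply: (mulrI (ux n)); rewrite (divrr (ux n)).
Qed.
Definition padic_inv x := padic_mk (padic_inv_subproof x).

Fact padic_mulVr : {in padic_unit, left_inverse 1 padic_inv *%R}.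
Proof.
move=> x ux; apply: padic_eqP => n /=; rewrite ux.
by apply: mulVr; exact: (elimT (asboolP (forall n, x n \is a GRing.unit)) ux).
Qed.
Fact padic_unitP (x y : padic_int) : y * x = 1 -> x \in padic_unit.
Proof.
move=> yx1; apply/asboolP => n; apply/unitrPr; exists (y n).
by rewrite mulrC; have := congr1 (fun z : padic_int => z n) yx1.
Qed.
Fact padic_inv_out : {in [predC padic_unit], padic_inv =1 id}.
Proof. by move=> x /negbTE ux; apply: padic_eqP => n /=; rewrite ux. Qed.

HB.instance Definition _ := GRing.ComNzRing_hasMulInverse.Build padic_int
  padic_mulVr padic_unitP padic_inv_out.

Lemma padic_coordD (x : padic_int) m n : (x (m + n)%N : nat)%:R = x m.
Proof.
elim: n => [|n IH]; first by rewrite addn0 -padic_natz.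
rewrite -IH addnS -(padic_coordP x (m + n)); apply: ord_inj.
rewrite !val_Zp_nat ?padic_gt1 // modn_dvdm //.
by rewrite dvdn_exp2l // ltnS leq_addr.
Qed.

Lemma padic_ndvd (x : padic_int) m n :
  x m != 0 -> ~~ (p ^ m.+1 %| x (m + n)%N)%N.
Proof.
apply: contraNN => dv; rewrite -(padic_coordD x m n); apply/eqP/ord_inj.
by rewrite val_Zp_nat ?padic_gt1 //=; apply/eqP.
Qed.

Fact padic_idomain (x y : padic_int) : x * y = 0 -> (x == 0) || (y == 0).
Proof.
move=> xy0; apply/orP; rewrite -(asboolE (_ \/ _)); apply: contraT.
move=> /asboolPn /not_orP [/negP x0 /negP y0].
have nz (z : padic_int) : z != 0 -> exists n, z n != 0.
  move=> /eqP z0; apply: contrapT => /forallNP H; apply: z0.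
  by apply: padic_eqP => n; apply/eqP; have /negP := H n; rewrite negbK.
have [[i xi] [j yj]] := (nz x x0, nz y y0).
have := padic_ndvd j.+1 xi; have := padic_ndvd i.+1 yj.
rewrite !addnS [(j + i)%N]addnC.
have := congr1 (fun z : padic_int => z (i + j).+1) xy0 => /=.
set a := x _; set b := y _; rewrite [a]padic_natz [b]padic_natz -natrM.
move=> /(congr1 (@nat_of_ord _)); rewrite val_Zp_nat ?padic_gt1 //= => /eqP dv.
rewrite !natr_Zp => nb na.
have a0 : (0 < a)%N by rewrite lt0n; apply: contraNneq na => ->; rewrite dvdn0.
have b0 : (0 < b)%N by rewrite lt0n; apply: contraNneq nb => ->; rewrite dvdn0.
move: dv na nb; rewrite -/(dvdn _ _) !pfactor_dvdn ?muln_gt0 ?a0 ?b0 //.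
rewrite lognM // -!ltnNge !ltnS => dv la lb.
by move: (leq_add la lb); rewrite leqNgt (leq_trans _ dv).
Qed.

HB.instance Definition _ :=
  GRing.ComUnitRing_isIntegral.Build padic_int padic_idomain.

(* Reduction Z_p -> Z/p^m, meaningful for m >= 1 ('Z_(p ^ 0) is Z/2). *)
Definition padic_mod (m : nat) (x : padic_int) : 'Z_(p ^ m) := (x m : nat)%:R.

Definition padic_character (chi : {unit 'F_p} -> padic_int) : Prop :=
  (forall x, chi x \is a GRing.unit) /\
  (forall x y, chi (x * y)%g = chi x * chi y).

Definition is_teichmuller (omega : {unit 'F_p} -> padic_int) : Prop :=
  padic_character omega /\
  (forall x : {unit 'F_p}, padic_mod 1 (omega x) = (val x : nat)%:R).

End PadicIntegers.

Notation padic_rat p_pr := {fraction padic_int p_pr}.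

(* Extension by 0 to R of a function defined on the units of R. *)
Definition unit_ext (R : finUnitRingType) (V : zmodType) (f : {unit R} -> V)
    (x : R) : V :=
  if insub x is Some v then f v else 0.

Section InverseCharacter.
Variables (p : nat) (p_pr : prime p) (chi : {unit 'F_p} -> padic_int p_pr).

(* chi^-1(a mod p), with value 0 when p | a. *)
Definition char_inv (a : nat) : padic_int p_pr :=
  unit_ext (fun x => (chi x)^-1) (a%:R : 'F_p).

(* B_{1,chi^-1}; it lives in Q_p because it need not be integral in general. *)
Definition bernoulli1_inv : padic_rat p_pr :=
  (p%:R)^-1 * \sum_(1 <= a < p) a%:R * FracField.tofrac (char_inv a).

End InverseCharacter.

Section CyclotomicIntegers.
Variables (L : fieldType) (z : L).

(* The ring Z[z], image of Z[X] under evaluation at z. *)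
Definition int_adjoin (x : L) : Prop :=
  exists f : {poly int}, x = (map_poly intr f).[z].

(* When F_N -> Z[z]/(u) is bijective, the element of F_N corresponding to the
   class of x in Z[z]/(u), that is the unique c with x = c mod u Z[z]. *)
Definition residue_class (N : nat) (u x : L) : 'F_N :=
  odflt 0 [pick c : 'F_N |
    `[< exists2 w, int_adjoin w & x - (c : nat)%:R = u * w >]].

End CyclotomicIntegers.

(* Main.v *)
(* Write m = (N - 1)/p, psi = chi^-1 and G(c) = log((c m)!) for 0 < c < p.  Reducing k modulo p
   and using p m = -1 in F_N, summation by parts turns the right-hand sum into
   - sum_c psi(c) G(c), and the left-hand sum is X = sum_c psi(c) x_c with x_c = log(sigma_c(u))
   and x_1 chosen so that the x_c add up to 0.

   For a different from 0 and -1 modulo p, a Jacobi sum J of two characters of order p of F_N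
   reduces modulo sigma_c^-1(u) to a binomial coefficient of the (c m)!, which is 0 exactly
   when adding c and a c produces a carry modulo p.  As J has absolute value sqrt N, it is
   the product of the sigma_c^-1(u) over these c, up to a cyclotomic integer of absolute
   value 1, hence up to a root of unity.  Taking logarithms, multiplying by psi(c) and summing
   gives - U S = B U X with S = sum_c psi(c) G(c) and U = 1 + chi(a) - chi(1 + a): the sum of
   psi over the carries is B U, and the root of unity contributes a multiple of p B times a
   p-torsion element.  For some a the number U is a unit, since otherwise chi(a) = a modulo p
   for all a and B would not be integral. *)

Require Import Defs.
From HB Require Import structures.
From mathcomp Require Import all_boot all_order all_fingroup all_algebra all_field.
From mathcomp Require Import cyclic boolp ring zify.

Set Implicit Arguments.
Unset Strict Implicit.
Unset Printing Implicit Defensive.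

Import Order.TTheory GRing.Theory Num.Theory.
Local Open Scope ring_scope.

(** * Exponents modulo a prime and evaluation of integer polynomials *)

Section ExponentsModP.
Variables (p : nat) (p_pr : prime p).

Lemma Fp_ltn (c : 'F_p) : (c < p)%N.
Proof. by rewrite -[X in (_ < X)%N](Fp_cast p_pr) ltn_ord. Qed.

Lemma Fp_eq (n k : nat) : (n%:R == k%:R :> 'F_p) = (n == k %[mod p]).
Proof. by rewrite -val_eqE /= !val_Fp_nat. Qed.

Lemma Fp_nat_eq0 (n : nat) : (n%:R == 0 :> 'F_p) = (p %| n)%N.
Proof. by rewrite (Fp_eq n 0) mod0n. Qed.

Lemma Fp_val_gt0 (c : 'F_p) : c != 0 -> (0 < c)%N.
Proof. by rewrite lt0n -val_eqE. Qed.

Lemma Fp_valD (c d : 'F_p) : (c + d : 'F_p) = ((c + d) %% p)%N :> nat.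
Proof. by rewrite -val_Fp_nat // natrD !natr_Zp. Qed.

Lemma Fp_valM (c d : 'F_p) : (c * d : 'F_p) = ((c * d) %% p)%N :> nat.
Proof. by rewrite -val_Fp_nat // natrM !natr_Zp. Qed.

Lemma Fp_valN (c : 'F_p) : c != 0 -> (- c : 'F_p) = (p - c)%N :> nat.
Proof.
move=> c0; have ltc := Fp_ltn c; have c_gt0 := Fp_val_gt0 c0.
have -> : - c = (p - c)%:R.
  by rewrite natrB 1?ltnW // natr_Zp pchar_Fp_0 // sub0r.
by rewrite val_Fp_nat // modn_small //; lia.
Qed.

Lemma Fp_val1 : (1 : 'F_p) = 1%N :> nat.
Proof. by rewrite (val_Fp_nat p_pr 1) modn_small // prime_gt1. Qed.

Lemma big_Fp (V : Type) (idx : V) (op : Monoid.com_law idx) (F : nat -> V) :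
  \big[op/idx]_(0 <= a < p) F a = \big[op/idx]_(c : 'F_p) F c.
Proof. by rewrite -[X in index_iota 0 X](Fp_cast p_pr) big_mkord. Qed.

Variables (K : nzRingType) (z : K).
Hypothesis zp : z ^+ p = 1.

Lemma exprFp_nat n : z ^+ (n%:R : 'F_p) = z ^+ n.
Proof. by rewrite val_Fp_nat // expr_mod. Qed.

Lemma exprFpD (c d : 'F_p) : z ^+ (c + d)%R = z ^+ c * z ^+ d.
Proof. by rewrite Fp_valD expr_mod // exprD. Qed.

Lemma exprFpM (c d : 'F_p) : z ^+ (c * d)%R = (z ^+ c) ^+ d.
Proof. by rewrite Fp_valM expr_mod // exprM. Qed.

Lemma exprFp_p (c : 'F_p) : (z ^+ c) ^+ p = 1.
Proof. by rewrite exprAC zp expr1n. Qed.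

End ExponentsModP.

Lemma prim_root_prime (K : idomainType) p (z : K) :
  prime p -> z ^+ p = 1 -> z != 1 -> p.-primitive_root z.
Proof.
move=> p_pr zp z1; have [m zm m_dvd] := prim_order_exists (prime_gt0 p_pr) zp.
suff /(prime_nt_dvdP p_pr)/(_ m_dvd) <- : m != 1 by [].
by apply: contraNneq z1 => m1; have := prim_expr_order zm; rewrite m1 expr1 => ->.
Qed.

Section PrimitiveRoots.
Variables (p : nat) (p_pr : prime p) (K : idomainType) (z : K).
Hypothesis z_prim : p.-primitive_root z.

Lemma exprFp_inj : injective (fun c : 'F_p => z ^+ c).
Proof.
move=> c d /eqP; rewrite (eq_prim_root_expr z_prim) -(Fp_eq p_pr) !natr_Zp.
by move/eqP.
Qed.

Lemma exprFp_prim (c : 'F_p) : c != 0 -> p.-primitive_root (z ^+ c).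
Proof.
move=> c0; have zp := prim_expr_order z_prim.
apply: prim_root_prime => //; first exact: exprFp_p.
by apply: contraNneq c0 => zc; apply/eqP/exprFp_inj; rewrite zc.
Qed.

Lemma sum_exprFp (k : 'F_p) : \sum_(c : 'F_p) z ^+ (c * k)%R = (p * (k == 0))%:R.
Proof.
have zp := prim_expr_order z_prim; have [->|k0] := eqVneq k 0.
  rewrite (eq_bigr (fun=> 1)) => [|c _]; last by rewrite mulr0.
  by rewrite sumr_const (card_Fp p_pr) muln1.
rewrite muln0; have <- : \sum_(c : 'F_p) z ^+ c = \sum_(c : 'F_p) z ^+ (c * k)%R.
  by rewrite (reindex_inj (mulIf k0)).
rewrite -(big_Fp p_pr _ (fun c => z ^+ c)) big_mkord.
have /eqP := subrX1 z p; rewrite zp subrr eq_sym mulf_eq0 subr_eq0 => /orP[|/eqP//].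
by have := eq_prim_root_expr z_prim 1 0; rewrite expr1 => -> ; rewrite mod0n modn_small ?prime_gt1.
Qed.

End PrimitiveRoots.

Section Evaluation.
Variables (K : comNzRingType) (z : K).

(** Elements of [Z[zeta]] are handled through integer polynomials, which can be evaluated at [zeta],
    at its conjugates and in ['F_N]. *)
Definition ev : {poly int} -> K := horner_eval z \o map_poly intr.
HB.instance Definition _ := GRing.RMorphism.on ev.

Lemma evE f : ev f = (map_poly intr f).[z].
Proof. by []. Qed.

Lemma evX n : ev 'X^n = z ^+ n.
Proof. by rewrite evE map_polyXn hornerXn. Qed.

Lemma evC c : ev c%:P = c%:~R.
Proof. by rewrite evE map_polyC hornerC. Qed.

End Evaluation.

Lemma ev_comp (K : comNzRingType) (z : K) n f : ev z (f \Po 'X^n) = ev (z ^+ n) f.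
Proof. by rewrite !evE map_comp_poly horner_comp map_polyXn hornerXn. Qed.

(** The [p]-th cyclotomic polynomial, for prime [p]. *)
Definition Phi (p : nat) : {poly int} := \poly_(i < p) 1.

(** * The prime cyclotomic polynomial *)

Section PrimeCyclotomic.
Variables (p : nat) (p_pr : prime p).

Lemma evPhi (K : comNzRingType) (z : K) : ev z (Phi p) = \sum_(i < p) z ^+ i.
Proof.
rewrite /Phi poly_def rmorph_sum; apply: eq_bigr => i _.
by rewrite scale1r /= evX.
Qed.

Lemma evPhi0 (K : idomainType) (z : K) : p.-primitive_root z -> ev z (Phi p) = 0.
Proof.
move=> z_prim; have := sum_exprFp p_pr z_prim 1.
rewrite oner_eq0 muln0 mulr0n => <-; rewrite evPhi -(big_mkord predT (fun c => z ^+ c)).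
by rewrite (big_Fp p_pr); apply: eq_bigr => c _; rewrite mulr1.
Qed.

Lemma size_Phi : size (Phi p) = p.
Proof. by rewrite /Phi size_poly_eq. Qed.

Lemma monic_Phi : Phi p \is monic.
Proof. by rewrite monicE /Phi lead_coef_poly ?prime_gt0. Qed.

Lemma Phi_division (g : {poly int}) :
  exists q s, g = q * Phi p + s /\ (size s < p)%N.
Proof.
exists (Pdiv.CommonRing.rdivp g (Phi p)), (Pdiv.CommonRing.rmodp g (Phi p)); split.
  exact: Pdiv.RingMonic.rdivp_eq monic_Phi g.
by rewrite -[X in (_ < X)%N]size_Phi Pdiv.Ring.ltn_rmodp monic_neq0 // monic_Phi.
Qed.

Lemma small_poly_eq0 (K : idomainType) (z : K) (s : {poly int}) :
    p.-primitive_root z -> (size s < p)%N ->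
    (forall c : 'F_p, c != 0 -> ev (z ^+ c) s = 0) ->
  map_poly (intr : int -> K) s = 0.
Proof.
move=> z_prim s_lt s0.
apply: (@roots_geq_poly_eq0 _ _ [seq z ^+ (c : 'F_p) | c <- enum (predC1 (0 : 'F_p))]).
- apply/allP => _ /mapP[c + ->]; rewrite mem_enum inE => c0.
  by apply/eqP; rewrite -evE s0.
- by rewrite map_inj_uniq ?enum_uniq //; apply: exprFp_inj.
rewrite size_map -cardE cardC1 card_Fp //; apply: leq_trans (size_poly _ _) _.
by rewrite -ltnS prednK // prime_gt0.
Qed.

(** An element of [Z[zeta]] lying in all primes above [N] is divisible by [N]: by [small_poly_eq0]
    over ['F_N], the coefficients of its remainder modulo [Phi p] are. *)
Lemma vanish_mod (N : nat) (N_pr : prime N) (r : 'F_N) (L : idomainType) (zeta : L) h :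
    p.-primitive_root r -> p.-primitive_root zeta ->
    (forall c : 'F_p, c != 0 -> ev (r ^+ c) h = 0) ->
  exists l, ev zeta h = N%:R * ev zeta l.
Proof.
move=> r_prim zeta_prim h0; have [q [s [hE s_lt]]] := Phi_division h.
have s0 : map_poly (intr : int -> 'F_N) s = 0.
  apply: (small_poly_eq0 r_prim s_lt) => c c0.
  have := h0 c c0; rewrite hE rmorphD rmorphM /= evPhi0 ?mulr0 ?add0r //.
  exact: exprFp_prim.
exists (\poly_(i < size s) (s`_i %/ N)%Z).
rewrite hE rmorphD rmorphM /= evPhi0 // mulr0 add0r.
have -> : N%:R = ev zeta N%:R by rewrite rmorph_nat.
rewrite -rmorphM; apply: (congr1 (ev zeta)); apply/polyP => i.
rewrite mulr_natl coefMn coef_poly; case: ltnP => [_|/leq_sizeP->//]; last by rewrite mul0rn.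
have /(congr1 (fun g : {poly _} => g`_i)) := s0.
rewrite coef_map coef0 => si0; have N_dvd : (N %| s`_i)%Z.
  by rewrite (dvdz_pcharf (pchar_Fp N_pr)) -[_%:~R]/(intr s`_i : 'F_N) si0.
by rewrite -mulr_natr natz divzK.
Qed.

Section Transfer.
Variables (L : idomainType) (zeta : L).
Hypothesis zeta_prim : p.-primitive_root zeta.
Hypothesis L_char0 : injective (intr : int -> L).
Hypothesis conj : forall (g : {poly int}) (c : 'F_p), c != 0 ->
  ev zeta g = 0 -> ev (zeta ^+ c) g = 0.

(** By [conj], the remainder modulo [Phi p] vanishes at all the conjugates of [zeta]. *)
Lemma Phi_dvd g : ev zeta g = 0 -> exists q, g = q * Phi p.
Proof.
move=> g0; have [q [s [gE s_lt]]] := Phi_division g; exists q.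
have s0 : map_poly (intr : int -> L) s = 0.
  apply: (small_poly_eq0 zeta_prim s_lt) => c c0.
  have := conj c0 g0; rewrite gE rmorphD rmorphM /= evPhi0 ?mulr0 ?add0r //.
  exact: exprFp_prim.
suff s_eq0 : s = 0 by rewrite gE s_eq0 addr0.
apply/polyP => i; have /(congr1 (fun g : {poly _} => g`_i)) := s0.
by rewrite coef_map !coef0 /= => si0; apply: L_char0; rewrite si0.
Qed.

(** As [Z[zeta]] is [Z[X]] modulo [Phi p], each root [z] of [Phi p] defines a ring morphism sending
    [zeta] to [z]. Identities pass this way to the conjugates and to ['F_N]. *)
Lemma ev_transfer (K : comNzRingType) (z : K) f g :
  ev z (Phi p) = 0 -> ev zeta f = ev zeta g -> ev z f = ev z g.
Proof.
move=> z0 fg; have [|q] := @Phi_dvd (f - g); first by rewrite rmorphB /= fg subrr.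
move/(congr1 (ev z)); rewrite rmorphB rmorphM /= z0 mulr0 => /eqP.
by rewrite subr_eq0 => /eqP.
Qed.

End Transfer.
End PrimeCyclotomic.

Lemma ev_rmorph (K K' : comNzRingType) (phi : {rmorphism K -> K'}) x f :
  phi (ev x f) = ev (phi x) f.
Proof.
rewrite !evE -horner_map -map_poly_comp; congr (_.[_]).
by apply: eq_map_poly => a /=; rewrite rmorph_int.
Qed.

Lemma Fp_expn1 N (N_pr : prime N) (x : 'F_N) : x != 0 -> x ^+ N.-1 = 1.
Proof.
move=> x0; apply: (mulfI x0); rewrite -exprS prednK ?prime_gt0 // mulr1.
by have := expf_card x; rewrite card_Fp.
Qed.

Lemma exists_expf_neq1 N (N_pr : prime N) m :
  (0 < m < N.-1)%N -> exists2 x : 'F_N, x != 0 & x ^+ m != 1.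
Proof.
move=> /andP[m_gt0 m_lt].
have [/existsP[x /andP[]]|] := boolP [exists x : 'F_N, (x != 0) && (x ^+ m != 1)].
  by exists x.
rewrite negb_exists => /forallP all1.
have : 'X^m - 1 = 0 :> {poly 'F_N}.
  apply: (@roots_geq_poly_eq0 _ _ (enum (predC1 (0 : 'F_N)))).
  - apply/allP => x; rewrite mem_enum inE => x0; have := all1 x.
    by rewrite negb_and negbK (negbTE x0) negbK /= rootE !hornerE subr_eq0.
  - exact: enum_uniq.
  by rewrite -cardE cardC1 card_Fp // size_XnsubC.
by move/eqP; rewrite -size_poly_eq0 size_XnsubC.
Qed.

(** * The residue field of a generator of a prime above N *)

Section ResidueField.
Variables (p N m : nat) (p_pr : prime p) (N_pr : prime N).
Hypotheses (N_eq : N = (p * m).+1).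
Variables (L : idomainType) (zeta : L).
Hypothesis zeta_prim : p.-primitive_root zeta.
Hypothesis L_char0 : injective (intr : int -> L).
Hypothesis conj : forall (g : {poly int}) (c : 'F_p), c != 0 ->
  ev zeta g = 0 -> ev (zeta ^+ c) g = 0.
Variable f : {poly int}.
Hypothesis f_norm : \prod_(c : 'F_p | c != 0) ev (zeta ^+ c) f = N%:R.

Lemma cofactor_gt0 : (0 < m)%N.
Proof. by case: m N_eq => // N1; move: N_pr; rewrite N1 muln0. Qed.

(* The witness x ^ (N m) has order dividing p modulo N^2 by Euler's theorem and is
   congruent to x ^ m modulo N. *)
Lemma exists_root_mod_sqr : exists R : nat,
  p.-primitive_root (R%:R : 'F_N) /\ ((N ^ 2)%:Z %| ev (R%:Z) (Phi p))%Z.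
Proof.
have m_gt0 := cofactor_gt0; have p_gt1 := prime_gt1 p_pr.
have [|x x0 xm] := @exists_expf_neq1 _ N_pr m; first by rewrite N_eq /=; nia.
have RE : ((x ^ (N * m))%N)%:R = x ^+ m.
  rewrite natrX natr_Zp exprM; congr (_ ^+ m).
  by have := expf_card x; rewrite card_Fp.
exists (x ^ (N * m))%N; rewrite RE; split.
  by apply: prim_root_prime => //; rewrite -exprM mulnC -[(p * m)%N]/((p * m).+1.-1) -N_eq Fp_expn1.
set R := (x ^ _)%N.
have evR : ev (R%:Z) (Phi p) = \sum_(i < p) (R%:Z) ^+ i := evPhi p _.
(* [R] is not 1 modulo [N], so multiplying by [R - 1] loses nothing and it suffices that [R^p = 1]
   modulo [N^2]. *)
have coprR : coprimez (N ^ 2)%:Z (R%:Z - 1).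
  rewrite coprimezE /= coprimeXl // prime_coprime //.
  rewrite -[(_ %| _)%N]/(N%:Z %| (R%:Z - 1))%Z (dvdz_pcharf (pchar_Fp N_pr)).
  by rewrite rmorphB /= rmorph1 -[_%:~R]/(R%:R : 'F_N) RE subr_eq0.
rewrite evR -(Gauss_dvdzr _ coprR) -subrX1 -eqz_mod_dvd.
have -> : R%:Z ^+ p = (R ^ p)%N by rewrite -!natz natrX.
rewrite -[X in (_ == X %[mod _])%Z]/(1%:Z) !modz_nat eqz_nat /R -expnM.
have -> : (N * m * p)%N = totient (N ^ 2).
  by rewrite totient_pfactor // {2}N_eq expn1 /=; nia.
apply/eqP/Euler_exp_totient; rewrite coprimeXr // coprime_sym prime_coprime //.
by rewrite gtnNdvd ?Fp_val_gt0 // Fp_ltn.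
Qed.

(* N^2 does not divide the norm of f(zeta), so exactly one conjugate of f vanishes modulo N. *)
Lemma exists_residue_root : exists r : 'F_N,
  [/\ p.-primitive_root r, ev r f = 0 &
      forall c : 'F_p, c != 0 -> c != 1 -> ev (r ^+ c) f != 0].
Proof.
have [R [rho_prim R_Phi]] := exists_root_mod_sqr; set rho : 'F_N := R%:R in rho_prim.
have rho_p := prim_expr_order rho_prim.
pose F := \prod_(c : 'F_p | c != 0) (f \Po 'X^c).
have evF (K : comNzRingType) (z : K) : ev z F = \prod_(c : 'F_p | c != 0) ev (z ^+ c) f.
  by rewrite /F rmorph_prod; apply: eq_bigr => c _; rewrite /= ev_comp.
have F_norm : ev zeta F = ev zeta N%:R by rewrite evF f_norm rmorph_nat.
have : ev rho F = 0.
  rewrite (ev_transfer p_pr zeta_prim L_char0 conj _ F_norm) ?evPhi0 //.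
  by rewrite rmorph_nat pchar_Fp_0.
rewrite evF => /eqP/prodf_eq0[c0 c00 /eqP fc0]; exists (rho ^+ c0).
split=> [||c c_0 c1]; [exact: exprFp_prim | by [] |].
rewrite -exprFpM //; apply/negP => /eqP fc0c.
have c0c : c0 * c != c0.
  by apply: contraNneq c1 => c0c; apply/eqP/(mulfI c00); rewrite c0c mulr1.
have N_dvd (c' : 'F_p) : ev (rho ^+ c') f = 0 -> (N %| ev ((R%:Z) ^+ c') f)%Z.
  move=> fc'; rewrite (dvdz_pcharf (pchar_Fp N_pr)).
  by rewrite (ev_rmorph (intr : {rmorphism int -> 'F_N})) rmorphXn /= -[_%:~R]/rho fc'.
(* Two vanishing conjugates contribute a factor [N] each to [F] at [R]. But [F - N] is a multiple of
   [Phi p], which is 0 modulo [N^2] at [R], so [N^2] would divide [N]. *)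
have N2_F : ((N ^ 2)%:Z %| ev (R%:Z) F)%Z.
  move: (c0 * c) (mulf_neq0 c00 c_0) c0c fc0c => c2 c20 c02 fc2.
  rewrite evF (bigD1 c0) //= (bigD1 c2) /= ?c20 // mulrA.
  by rewrite dvdz_mulr // expnS expn1 PoszM; apply: dvdz_mul; apply: N_dvd.
have [|q FE] := @Phi_dvd _ p_pr _ _ zeta_prim L_char0 conj (F - N%:R).
  by rewrite rmorphB /= F_norm subrr.
have : ((N ^ 2)%:Z %| N%:Z)%Z.
  have -> : N%:Z = ev (R%:Z) F - ev (R%:Z) (q * Phi p).
    by rewrite -FE rmorphB /= rmorph_nat opprB addrC subrK natz.
  by rewrite rmorphM /= rpredB // dvdz_mull.
rewrite dvdzE /= => /dvdn_leq; rewrite prime_gt0 // => /(_ isT).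
by rewrite leqNgt expnS expn1 ltn_Pmull ?prime_gt1 ?prime_gt0.
Qed.

Variable r : 'F_N.
Hypotheses (r_prim : p.-primitive_root r) (fr0 : ev r f = 0).
Hypothesis fr_neq0 : forall c : 'F_p, c != 0 -> c != 1 -> ev (r ^+ c) f != 0.

Lemma N_neq0 : N%:R != 0 :> L.
Proof.
rewrite -[_%:R]/((N%:Z)%:~R); apply/eqP; rewrite -[0]/(0%:~R) => /L_char0 [N0].
by move: N_pr; rewrite N0.
Qed.

(** Let [v] be the product of the other conjugates of [u = ev zeta f], so that [u v = N]. Then [v h]
    vanishes at [r ^+ c], through [h] if [c = 1] and through the factor of index [c^-1] otherwise;
    so [N] divides [v h], and [v] cancels. *)
Lemma residue_kernel h : ev r h = 0 -> exists w, ev zeta h = ev zeta f * ev zeta w.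
Proof.
move=> hr0; pose v := \prod_(c : 'F_p | (c != 0) && (c != 1)) (f \Po 'X^c).
have evv (K : comNzRingType) (z : K) :
    ev z v = \prod_(c : 'F_p | (c != 0) && (c != 1)) ev (z ^+ c) f.
  by rewrite /v rmorph_prod; apply: eq_bigr => c _; rewrite /= ev_comp.
have N_split : N%:R = ev zeta f * ev zeta v.
  by rewrite -f_norm (bigD1 1) ?oner_neq0 // evv Fp_val1 // expr1.
have vh0 (c : 'F_p) : c != 0 -> ev (r ^+ c) (v * h) = 0.
  move=> c0; rewrite rmorphM /=; have [->|c1] := eqVneq c 1.
    by rewrite Fp_val1 // expr1 hr0 mulr0.
  rewrite evv (bigD1 c^-1) /=; last by rewrite invr_eq0 c0 invr_eq1.
  by rewrite -exprFpM ?(prim_expr_order r_prim) // mulfV // Fp_val1 // expr1 fr0 !mul0r.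
have [l vhE] := vanish_mod p_pr N_pr r_prim zeta_prim vh0; exists l.
have v_neq0 : ev zeta v != 0.
  by apply: contraNneq N_neq0 => v0; rewrite N_split v0 mulr0.
apply: (mulfI v_neq0); move: vhE; rewrite rmorphM /= => ->; rewrite N_split; ring.
Qed.
End ResidueField.

(** Evaluation at [r] has kernel [(u)] with [u = ev zeta f], so it identifies [Z[zeta]/(u)] with
    ['F_N], and [pick] has only one candidate. *)
Lemma residue_classE (L : fieldType) (zeta : L) p N (p_pr : prime p) (N_pr : prime N)
    (zeta_prim : p.-primitive_root zeta) (L_char0 : injective (intr : int -> L))
    (conj : forall (g : {poly int}) (c : 'F_p), c != 0 ->
       ev zeta g = 0 -> ev (zeta ^+ c) g = 0)
    (f : {poly int}) (f_norm : \prod_(c : 'F_p | c != 0) ev (zeta ^+ c) f = N%:R)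
    (r : 'F_N) (r_prim : p.-primitive_root r) (fr0 : ev r f = 0) g :
  residue_class zeta N (ev zeta f) (ev zeta g) = ev r g.
Proof.
have classE (c : 'F_N) : reflect (c = ev r g)
    `[< exists2 w, int_adjoin zeta w & ev zeta g - (c : nat)%:R = ev zeta f * w >].
  apply: (iffP idP) => [/asboolP[_ [w ->]]|->].
    rewrite -evE -[(c : nat)%:R](rmorph_nat (ev zeta)) -rmorphB -rmorphM /=.
    move/(ev_transfer p_pr zeta_prim L_char0 conj (evPhi0 p_pr r_prim)).
    rewrite rmorphM rmorphB /= rmorph_nat natr_Zp fr0 mul0r => /eqP.
    by rewrite subr_eq0 => /eqP.
  apply/asboolP; set c0 := ev r g.
  have [|w gE] := residue_kernel p_pr N_pr zeta_prim L_char0 f_norm r_prim fr0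
      (_ : ev r (g - (c0 : nat)%:R) = 0).
    by rewrite rmorphB /= rmorph_nat natr_Zp subrr.
  exists (ev zeta w); first by exists w.
  by rewrite -gE rmorphB /= rmorph_nat.
rewrite /residue_class; case: pickP => [c /classE-> //|/(_ (ev r g))].
by move/negP; case; apply/classE.
Qed.

Lemma int_sum_sqr_eq1 (I : finType) (a : I -> int) :
  \sum_i a i ^+ 2 = 1 -> exists (b : bool) (i0 : I), forall i, a i = (-1) ^+ b *+ (i == i0).
Proof.
move=> sum1.
have [/existsP[i0 ai0]|] := boolP [exists i, a i != 0]; last first.
  rewrite negb_exists => /forallP a0; move: sum1; rewrite big1 // => i _.
  by have := a0 i; rewrite negbK => /eqP->; rewrite expr0n.
have sq_ge0 i : (0 <= a i ^+ 2)%R by rewrite sqr_ge0.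
have rest_ge0 : (0 <= \sum_(i | i != i0) a i ^+ 2)%R by apply: sumr_ge0.
move: sum1; rewrite (bigD1 i0) //=; set S := \sum_(i | _) _ in rest_ge0 * => sum1.
have ai0E : a i0 = 1 \/ a i0 = -1 by rewrite expr2 in sum1; nia.
have S0 : S = 0 by case: ai0E => e; move: sum1; rewrite e ?sqrrN expr1n => /(canRL (addKr _)); rewrite addNr.
have a0 i : i != i0 -> a i = 0.
  move=> ii0; apply/eqP; rewrite -sqrf_eq0.
  by move/psumr_eq0P: S0 => /(_ (fun i _ => sq_ge0 i)) ->.
exists (a i0 == -1), i0 => i; have [->|/a0->//] := eqVneq i i0.
by case: ai0E => ->.
Qed.

(** * Cyclotomic integers of absolute value one *)

Section UnitsOfAbsoluteValueOne.
Variables (p : nat) (p_pr : prime p) (L : idomainType) (zeta : L).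
Hypothesis zeta_prim : p.-primitive_root zeta.
Hypothesis L_char0 : injective (intr : int -> L).
Hypothesis conj : forall (g : {poly int}) (c : 'F_p), c != 0 ->
  ev zeta g = 0 -> ev (zeta ^+ c) g = 0.

(** The coefficients of [g] modulo [X^p - 1]. *)
Definition coef_mod (g : {poly int}) (i : 'F_p) : int :=
  \sum_(n < size g | n%:R == i) g`_n.

Lemma ev_coef_mod (K : comNzRingType) (z : K) g :
  z ^+ p = 1 -> ev z g = \sum_(i : 'F_p) (coef_mod g i)%:~R * z ^+ i.
Proof.
move=> zp; rewrite -{1}[g]coefK poly_def rmorph_sum.
rewrite (partition_big (fun n : 'I_(size g) => n%:R : 'F_p) predT) //=.
apply: eq_bigr => i _; rewrite /coef_mod rmorph_sum mulr_suml.
apply: eq_bigr => n /eqP <-; rewrite exprFp_nat //.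
by rewrite -mul_polyC rmorphM /= evC evX.
Qed.

Lemma sum_zeta0 : \sum_(i : 'F_p) zeta ^+ i = 0.
Proof.
have := sum_exprFp p_pr zeta_prim 1; rewrite oner_eq0 muln0 mulr0n => {2}<-.
by apply: eq_bigr => i _; rewrite mulr1.
Qed.

(** Parseval's identity on [Z/p], for the products of [g] at [zeta ^+ c] and at its inverse: the one
    at [c = 0] is the square of the sum of the [a i], and the [p - 1] others are conjugates of 1. *)
Lemma trace_abs1 g (a := coef_mod g) :
    ev zeta g * ev (zeta ^+ (- (1 : 'F_p))%R) g = 1 ->
  p%:Z * \sum_i a i ^+ 2 = p%:Z - 1 + (\sum_i a i) ^+ 2.
Proof.
(* Kept opaque so that simplification does not compute the representative of -1. *)
have [e eN1] : exists e : 'F_p, e = - 1 by exists (- 1).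
rewrite -eN1 => gg; apply: L_char0.
have zp := prim_expr_order zeta_prim.
pose S (c : 'F_p) := ev (zeta ^+ c) g * ev (zeta ^+ (- c)%R) g.
have S1 c : c != 0 -> S c = 1.
  move=> c0; have : ev zeta (g * (g \Po 'X^e)) = ev zeta 1.
    by rewrite rmorphM rmorph1 /= ev_comp.
  have Phi0 : ev (zeta ^+ c) (Phi p) = 0 by apply/evPhi0/exprFp_prim.
  move/(ev_transfer p_pr zeta_prim L_char0 conj Phi0).
  by rewrite rmorphM rmorph1 /= ev_comp -exprFpM // eN1 mulrN1.
have S0 : S 0 = ((\sum_i a i) ^+ 2)%:~R.
  rewrite /S oppr0 expr0 ev_coef_mod ?expr1n // expr2 rmorphM /= rmorph_sum.
  by congr (_ * _); apply: eq_bigr => i _; rewrite expr1n mulr1.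
have SE : \sum_c S c = p%:R * (\sum_i a i ^+ 2)%:~R.
  have SEc c : S c = \sum_i \sum_j (a i * a j)%:~R * zeta ^+ (c * (i - j))%R.
    rewrite /S !ev_coef_mod ?exprFp_p // mulr_suml; apply: eq_bigr => i _.
    rewrite mulr_sumr; apply: eq_bigr => j _.
    by rewrite mulrACA -rmorphM -!exprFpM // -exprFpD // mulNr mulrBr.
  rewrite (eq_bigr _ (fun c _ => SEc c)) exchange_big rmorph_sum mulr_sumr.
  apply: eq_bigr => i _; rewrite exchange_big (bigD1 i) // [X in _ + X = _]big1.
    rewrite -mulr_sumr sum_exprFp // subrr eqxx muln1 addr0 expr2; ring.
  move=> j ji; rewrite -mulr_sumr sum_exprFp // subr_eq0 eq_sym (negbTE ji).
  by rewrite muln0 mulr0.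
move: SE; rewrite (bigD1 0) //= S0 (eq_bigr _ S1).
rewrite sumr_const cardC1 card_Fp // => SE.
rewrite rmorphM /= -[(p%:Z)%:~R]/(p%:R) -SE rmorphD /= addrC; congr (_ + _).
by rewrite rmorphB /= rmorph1 -subn1 natrB ?prime_gt0.
Qed.

(** The trace identity shows that the sum [s] of the coefficients has square 1 modulo [p], hence is
    1 or -1 modulo [p]. *)
Lemma abs1_root_of_unity g :
    ev zeta g * ev (zeta ^+ (- (1 : 'F_p))%R) g = 1 ->
  exists (b : bool) (k : 'F_p), ev zeta g = (-1) ^+ b * zeta ^+ k.
Proof.
move=> /trace_abs1; set a := coef_mod g; set s := \sum_i a i => traceE.
have [e [k [e2 sE]]] : exists e k : int, e ^+ 2 = 1 /\ s = e + p%:Z * k.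
  have : (p%:Z %| (s - 1) * (s + 1))%Z.
    apply/dvdzP; exists (\sum_i a i ^+ 2 - 1); rewrite [RHS]mulrC mulrBr traceE; ring.
  rewrite dvdzE abszM /= Euclid_dvdM // => /orP[dvd_s|dvd_s].
    have /dvdzP[k kE] : (p %| s - 1)%Z by [].
    exists 1, k; split; first by rewrite expr1n.
    by rewrite mulrC -kE; ring.
  have /dvdzP[k kE] : (p %| s + 1)%Z by [].
  exists (-1), k; split; first by rewrite sqrrN expr1n.
  by rewrite mulrC -kE; ring.
(* The coefficients matter only up to a common shift; the shift by k makes their sum e = 1 or -1,
   so that the trace form leaves a single nonzero coefficient. *)
have shift2 : \sum_i (a i - k) ^+ 2 = 1.
  have p0 : p%:Z != 0 by rewrite eqz_nat -lt0n prime_gt0.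
  apply: (mulfI p0).
  have -> : \sum_i (a i - k) ^+ 2 = \sum_i a i ^+ 2 - 2%:Z * k * s + p%:Z * k ^+ 2.
    have <- : \sum_(i : 'F_p) k ^+ 2 = p%:Z * k ^+ 2.
      by rewrite sumr_const card_Fp // -mulr_natl natz.
    rewrite /s mulr_sumr -sumrB -big_split /=.
    by apply: eq_bigr => i _; ring.
  (* Multiplied by [p], the shifted sum is [p - 1 + (s - p k)^2 = p - 1 + e^2]. *)
  by rewrite mulrDr mulrBr traceE sE; move: e2; rewrite !expr2 => e2; lia.
have [b [k0 aE]] := int_sum_sqr_eq1 shift2; exists b, k0.
have zp := prim_expr_order zeta_prim.
have k_sum0 : \sum_(i : 'F_p) k%:~R * zeta ^+ i = 0.
  by rewrite -mulr_sumr sum_zeta0 mulr0.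
rewrite ev_coef_mod // -[LHS]subr0 -[X in _ - X]k_sum0 -sumrB.
rewrite (bigD1 k0) //= big1 ?addr0 => [|i ik].
  by rewrite -mulrBl -rmorphB aE eqxx mulr1n rmorphXn /= rmorphN1.
by rewrite -mulrBl -rmorphB aE (negbTE ik) mul0r.
Qed.
End UnitsOfAbsoluteValueOne.

(** * Jacobi sums *)

Section JacobiSums.
Variables (p N m : nat) (p_pr : prime p) (N_pr : prime N).
Hypotheses (N_eq : N = (p * m).+1).
Variable r : 'F_N.
Hypothesis r_prim : p.-primitive_root r.

Lemma Fp_expr_pm (x : 'F_N) : x != 0 -> x ^+ (p * m) = 1.
Proof. by move=> x0; rewrite -[(p * m)%N]/((p * m).+1.-1) -N_eq Fp_expn1. Qed.

(** By Fermat [x ^- m] is a [p]-th root of unity, hence a power of [r]. The index [t] is a discrete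
    logarithm modulo [p]. *)
Lemma exists_index : exists t : 'F_N -> 'F_p, forall x, x != 0 -> r ^+ (t x) * x ^+ m = 1.
Proof.
apply: (@fin_all_exists _ _ (fun x (k : 'F_p) => x != 0 -> r ^+ k * x ^+ m = 1)) => x.
have [-> | x0] := eqVneq x 0; first by exists 0.
have [|i iE] := prim_rootP r_prim (_ : (x ^- m) ^+ p = 1).
  by rewrite exprVn -exprM mulnC Fp_expr_pm // invr1.
exists (i%:R) => _; rewrite exprFp_nat ?(prim_expr_order r_prim) // -iE mulVf //.
by rewrite expf_neq0.
Qed.

(** [N - 1] is the only multiple of [N - 1] in this range. For any other [e] some [g] has [g ^+ e]
    different from 1, and replacing [x] by [g x] multiplies the sum by [g ^+ e]. *)
Lemma power_sum e : (0 < e < 2 * N.-1)%N ->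
  \sum_(x : 'F_N) x ^+ e = - (e == N.-1)%:R.
Proof.
move=> /andP[e_gt0 e_lt]; have [->|eN] := eqVneq e N.-1.
  have N1 : (0 < N.-1)%N by rewrite -ltnS prednK ?prime_gt1 ?prime_gt0.
  rewrite (bigD1 0) //= expr0n eqn0Ngt N1 add0r.
  rewrite (eq_bigr (fun=> 1)) => [|x x0]; last exact: Fp_expn1.
  rewrite sumr_const cardC1 card_Fp // -subn1 natrB ?prime_gt0 //.
  by rewrite pchar_Fp_0 // sub0r.
have [g g0 ge] : exists2 g : 'F_N, g != 0 & g ^+ e != 1.
  have [lt_e|le_e] := ltnP e N.-1; first by apply: exists_expf_neq1; rewrite ?e_gt0.
  have [|g g0 ge] := @exists_expf_neq1 _ N_pr (e - N.-1); first by lia.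
  by exists g => //; rewrite -(subnK le_e) exprD (Fp_expn1 N_pr g0) mulr1.
have : \sum_(x : 'F_N) x ^+ e = g ^+ e * \sum_(x : 'F_N) x ^+ e.
  rewrite {1}(reindex_inj (mulfI g0)) mulr_sumr; apply: eq_bigr => x _.
  by rewrite -exprMn.
move/eqP; rewrite -subr_eq0 -{1}[\sum_x _]mul1r -mulrBl mulf_eq0 subr_eq0.
by rewrite eq_sym (negbTE ge) => /eqP->; rewrite oppr0.
Qed.

(** After expanding [(1 - x) ^+ j], [power_sum] keeps only the term of total exponent [N - 1]. *)
Lemma beta_sum i j : (0 < i <= N.-1)%N -> (i + j < 2 * N.-1)%N ->
  \sum_(x : 'F_N) x ^+ i * (1 - x) ^+ j = - ((-1) ^+ (N.-1 - i) *+ 'C(j, N.-1 - i)).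
Proof.
move=> /andP[i_gt0 i_le] ij.
under eq_bigr => x _ do rewrite exprBn mulr_sumr.
rewrite exchange_big /=.
have termE (l : 'I_j.+1) :
    \sum_(x : 'F_N) x ^+ i * ((-1) ^+ l * 1 ^+ (j - l) * x ^+ l *+ 'C(j, l))
    = - (l == N.-1 - i :> nat)%N%:R * ((-1) ^+ l *+ 'C(j, l)).
  have -> : (l == N.-1 - i :> nat)%N = ((i + l)%N == N.-1) by lia.
  rewrite -power_sum ?mulr_suml; last by have := ltn_ord l; lia.
  apply: eq_bigr => x _; rewrite expr1n mulr1 exprD -mulrA; congr (_ * _).
  by rewrite mulrnAr mulrC.
under eq_bigr => l _ do rewrite termE.
have [lt_j|le_j] := ltnP (N.-1 - i) j.+1.
  rewrite (bigD1 (Ordinal lt_j)) //= eqxx mulN1r big1 ?addr0 // => l.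
  by rewrite -val_eqE /= => /negbTE->; rewrite oppr0 mul0r.
rewrite bin_small // mulr0n oppr0 big1 // => l _.
by rewrite ltn_eqF ?(leq_trans (ltn_ord l)) // oppr0 mul0r.
Qed.

Variable t : 'F_N -> 'F_p.
Hypothesis tE : forall x, x != 0 -> r ^+ (t x) * x ^+ m = 1.

Let rp := prim_expr_order r_prim.

Lemma indexM x y : x != 0 -> y != 0 -> t (x * y) = t x + t y.
Proof.
move=> x0 y0; apply: (exprFp_inj p_pr r_prim) => /=; rewrite exprFpD //.
have xym : (x * y) ^+ m != 0 by rewrite expf_neq0 // mulf_neq0.
by apply: (mulIf xym); rewrite tE ?mulf_neq0 // exprMn mulrACA !tE // mulr1.
Qed.

Lemma index1 : t 1 = 0.
Proof. by apply: (addrI (t 1)); rewrite -indexM ?oner_neq0 // mulr1 addr0. Qed.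

Lemma indexV x : x != 0 -> t x^-1 = - t x.
Proof.
move=> x0; apply: (addrI (t x)).
by rewrite -indexM ?invr_eq0 // mulfV // index1 subrr.
Qed.

(** Here [r ^+ t x] is [x ^- m]; adding [p m = N - 1] makes the exponent [- c m] nonnegative. *)
Lemma index_pow (c : 'F_p) x : x != 0 -> (r ^+ (t x)) ^+ c = x ^+ ((p - c) * m).
Proof.
move=> x0; have c_lt := Fp_ltn p_pr c.
have xc : x ^+ (m * c) != 0 by rewrite expf_neq0.
apply: (mulIf xc); rewrite exprM -exprMn tE // expr1n -exprM -exprD.
by rewrite mulnC -mulnDr subnK 1?ltnW // mulnC Fp_expr_pm.
Qed.

(* The Jacobi sum of T and T^a for the character T(x) = z ^ t x, as a polynomial in z; modulo
   the prime (u), T is x |-> x ^ - m. *)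
Definition jacobi (a : 'F_p) : {poly int} :=
  \sum_(x : 'F_N | (x != 0) && (x != 1)) 'X^((t x + a * t (1 - x))%R).

Lemma jacobiE (K : comNzRingType) (z : K) a :
  ev z (jacobi a) = \sum_(x : 'F_N | (x != 0) && (x != 1)) z ^+ (t x + a * t (1 - x))%R.
Proof. by rewrite rmorph_sum; apply: eq_bigr => x _; apply: evX. Qed.

Lemma sum_neq01 (F : 'F_N -> 'F_N) : F 0 = 0 -> F 1 = 0 ->
  \sum_x F x = \sum_(x | (x != 0) && (x != 1)) F x.
Proof.
move=> F0 F1; rewrite (bigD1 0) //= F0 add0r (bigD1 1) ?oner_neq0 //=.
by rewrite F1 add0r.
Qed.

(** By [index_pow] this is a beta sum with exponents [(p - c) m] and [(p - a c) m]; both are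
    positive, so the terms at 0 and 1 can be added. *)
Lemma jacobi_residue (a c : 'F_p) : a != 0 -> c != 0 ->
  ev (r ^+ c) (jacobi a) = - ((-1) ^+ (c * m) *+ 'C((p - (a * c)%R) * m, c * m)).
Proof.
move=> a0 c0; have ac0 := mulf_neq0 a0 c0.
have c_lt := Fp_ltn p_pr c; have c_gt0 := Fp_val_gt0 c0.
have ac_lt := Fp_ltn p_pr (a * c); have ac_gt0 := Fp_val_gt0 ac0.
have m_gt0 := cofactor_gt0 N_pr N_eq.
have NmE : (c * m)%N = (N.-1 - (p - c) * m)%N by rewrite N_eq /=; nia.
rewrite NmE -beta_sum; try by rewrite N_eq /=; nia.
set i := ((p - c) * m)%N; set j := ((p - (a * c)%R) * m)%N.
have i_gt0 : (0 < i)%N by rewrite muln_gt0 subn_gt0 c_lt.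
have j_gt0 : (0 < j)%N by rewrite muln_gt0 subn_gt0 ac_lt.
have zero_i : 0 ^+ i = 0 :> 'F_N by rewrite expr0n gtn_eqF.
have zero_j : 0 ^+ j = 0 :> 'F_N by rewrite expr0n gtn_eqF.
rewrite jacobiE (sum_neq01 (F := fun x => x ^+ i * (1 - x) ^+ j)); first last.
- by rewrite subrr zero_j mulr0.
- by rewrite zero_i mul0r.
apply: eq_bigr => x /andP[x0 x1].
have x10 : 1 - x != 0 by rewrite subr_eq0 eq_sym.
rewrite exprFpD ?exprFp_p // exprAC index_pow //; congr (_ * _).
have -> : (r ^+ c) ^+ (a * t (1 - x))%R = (r ^+ t (1 - x)) ^+ (a * c)%R.
  by rewrite -!exprFpM //; have -> : c * (a * t (1 - x)) = t (1 - x) * (a * c) by ring.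
by rewrite index_pow.
Qed.

Lemma index_nontrivial : exists2 x, x != 0 & t x != 0.
Proof.
have m_gt0 := cofactor_gt0 N_pr N_eq; have p_gt1 := prime_gt1 p_pr.
have [|x x0 xm] := @exists_expf_neq1 _ N_pr m; first by rewrite N_eq /=; nia.
by exists x => //; apply: contraNneq xm => tx; rewrite -(tE x0) tx mul1r.
Qed.

Section AbsoluteValue.
Variables (L : idomainType) (zeta : L).
Hypothesis zeta_prim : p.-primitive_root zeta.
Let zp := prim_expr_order zeta_prim.

(** A nontrivial character sums to 0 over the nonzero elements, and the omitted value at 1 is 1. *)
Lemma index_sum (k : 'F_p) : k != 0 ->
  \sum_(x : 'F_N | (x != 0) && (x != 1)) zeta ^+ (k * t x)%R = - 1.
Proof.
move=> k0; have [g g0 tg] := index_nontrivial.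
have : \sum_(x : 'F_N | x != 0) zeta ^+ (k * t x)%R =
    zeta ^+ (k * t g)%R * \sum_(x : 'F_N | x != 0) zeta ^+ (k * t x)%R.
  rewrite {1}(reindex_inj (mulfI g0)) mulr_sumr.
  apply: eq_big => x; first by rewrite mulf_eq0 negb_or g0.
  by rewrite mulf_eq0 negb_or g0 => x0; rewrite indexM // mulrDr exprFpD.
move/eqP; rewrite -subr_eq0 -{1}[\sum_(x | _) _]mul1r -mulrBl mulf_eq0 subr_eq0.
have /negbTE-> : 1 != zeta ^+ (k * t g)%R.
  apply: contraNneq (mulf_neq0 k0 tg) => e.
  by apply/eqP/(exprFp_inj p_pr zeta_prim); rewrite -e.
rewrite (bigD1 1) ?oner_neq0 // index1 mulr0 expr0 orFb => /eqP e.
by apply/eqP; rewrite -addr_eq0 addrC; apply/eqP.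
Qed.

(** In the double sum for the product, the [N - 2] diagonal terms are 1. Off the diagonal, the
    variables [s = x / y] and [u = (1 - x) / (1 - y)] leave sums of nontrivial characters, worth 2
    in total. *)
Lemma jacobi_abs (a : 'F_p) : a != 0 -> a != - 1 ->
  ev zeta (jacobi a) * ev (zeta ^+ (- (1 : 'F_p))%R) (jacobi a) = N%:R.
Proof.
move=> a0 a1; pose D := [pred x : 'F_N | (x != 0) && (x != 1)].
pose T (s u : 'F_N) := zeta ^+ (t s + a * t u)%R.
have -> : ev zeta (jacobi a) * ev (zeta ^+ (- (1 : 'F_p))%R) (jacobi a) =
    \sum_(x | D x) \sum_(y | D y) T (x / y) ((1 - x) / (1 - y)).
  rewrite !jacobiE mulr_suml; apply: eq_bigr => x /andP[x0 x1].
  rewrite mulr_sumr; apply: eq_bigr => y /andP[y0 y1].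
  have x10 : 1 - x != 0 by rewrite subr_eq0 eq_sym.
  have y10 : 1 - y != 0 by rewrite subr_eq0 eq_sym.
  rewrite -exprFpM // -exprFpD // /T !indexM ?invr_eq0 // !indexV //.
  congr (zeta ^+ nat_of_ord _); ring.
have diag x : D x -> T (x / x) ((1 - x) / (1 - x)) = 1.
  move=> /andP[x0 x1]; rewrite !divff // ?subr_eq0 1?eq_sym //.
  by rewrite /T !index1 mulr0 addr0.
have offdiag : \sum_(x | D x) \sum_(y | D y && (y != x)) T (x / y) ((1 - x) / (1 - y))
    = \sum_(s | D s) \sum_(u | D u && (u != s)) T s u.
  rewrite !pair_big_dep /=.
  pose h (q : 'F_N * 'F_N) := (q.1 / q.2, (1 - q.1) / (1 - q.2)).
  (* [h'] solves [x = s y] and [1 - x = u (1 - y)] for [x] and [y]. *)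
  pose h' (q : 'F_N * 'F_N) :=
    (q.1 * (1 - q.2) / (q.1 - q.2), (1 - q.2) / (q.1 - q.2)).
  rewrite [RHS](reindex_onto h h') => [|[s u]] /=; last first.
    move=> /andP[/andP[s0 s1] /andP[/andP[u0 u1] us]]; rewrite /h /h' /=.
    have su : s - u != 0 by rewrite subr_eq0 eq_sym.
    have u10 : 1 - u != 0 by rewrite subr_eq0 eq_sym.
    have s10 : s - u - (1 - u) != 0 
      by rewrite (_ : s - u - (1 - u) = s - 1) ?subr_eq0 //; ring.
    by congr pair; field; rewrite su ?u10 ?s10.
  apply: eq_bigl => -[x y]; rewrite /h /h' /=.
  apply/andP/andP => [[/andP[x0 x1] /andP[/andP[y0 y1] yx]]|[/andP[]]].
    have xy : x - y != 0 by rewrite subr_eq0 eq_sym.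
    have x10 : 1 - x != 0 by rewrite subr_eq0 eq_sym.
    have y10 : 1 - y != 0 by rewrite subr_eq0 eq_sym.
    have xyE : x / y - (1 - x) / (1 - y) = (x - y) / (y * (1 - y)).
      by field; rewrite y0 y10.
    have uE : 1 - (1 - x) / (1 - y) = (x - y) / (1 - y) by field.
    have y0' := y0; rewrite -invr_eq0 in y0'.
    have y10' := y10; rewrite -invr_eq0 in y10'.
    have s1 : x / y != 1 by rewrite -subr_eq0 -[1](divff y0) -mulrBl mulf_neq0.
    have u1 : (1 - x) / (1 - y) != 1 by rewrite eq_sym -subr_eq0 uE mulf_neq0.
    have us : (1 - x) / (1 - y) != x / y.
      by rewrite eq_sym -subr_eq0 xyE mulf_neq0 // invr_eq0 mulf_neq0.
    split; first by rewrite s1 u1 us !mulf_neq0.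
    apply/eqP; rewrite uE xyE.
    by congr pair; field; rewrite ?xy ?y0 ?y10.
  rewrite !mulf_eq0 !invr_eq0 !negb_or !subr_eq0.
  move=> /andP[/andP[x0 y0] xy] /andP[/andP[/andP[x1 y1] _] _] _.
  rewrite x0 y0 eq_sym x1 eq_sym y1; split=> //=.
  by apply: contraNneq xy => ->; rewrite divff.
have inner s : D s -> \sum_(u | D u && (u != s)) T s u
    = - zeta ^+ (1 * t s)%R - zeta ^+ ((1 + a) * t s)%R.
  move=> Ds; have sumT : \sum_(u | D u) T s u = - zeta ^+ (1 * t s)%R.
    rewrite -[RHS]mulr1 mulNr -mulrN -(index_sum a0) mulr_sumr.
    by apply: eq_bigr => u _; rewrite /T mul1r exprFpD.
  have -> : zeta ^+ ((1 + a) * t s)%R = T s s by rewrite /T mulrDl mul1r.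
  by rewrite -sumT [in RHS](bigD1 s) //= addrAC subrr add0r.
have card_D : #|D| = (N - 2)%N.
  have <- : #|predC (pred2 (0 : 'F_N) 1)| = #|D|.
    by apply: eq_card => x; rewrite !inE negb_or.
  have := cardC (pred2 (0 : 'F_N) 1); rewrite card2 eq_sym oner_neq0 => cardE.
  by rewrite -[N in RHS](card_Fp N_pr) -cardE addKn.
rewrite (eq_bigr (fun x => 1 + \sum_(y | D y && (y != x)) T (x / y) ((1 - x) / (1 - y)))); last first.
  by move=> x Dx; rewrite (bigD1 x) //= diag.
rewrite big_split /= offdiag sumr_const card_D (eq_bigr _ inner) sumrB sumrN.
rewrite !index_sum ?oner_neq0 //; last by rewrite addrC addr_eq0.
by rewrite natrB ?prime_gt1 //; ring.
Qed.

End AbsoluteValue.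
End JacobiSums.

(** * Logarithms of factorials and of conjugates *)

Section KeyIdentity.
Variables (p N m : nat) (p_pr : prime p) (N_pr : prime N).
Hypotheses (N_eq : N = (p * m).+1).
Variables (V : zmodType) (lg : 'F_N -> V).
Hypothesis lgM : forall x y, x != 0 -> y != 0 -> lg (x * y) = lg x + lg y.
Hypothesis lgN1 : lg (- 1) = 0.

Lemma lg1 : lg 1 = 0.
Proof. by apply: (addrI (lg 1)); rewrite -lgM ?oner_neq0 // mulr1 addr0. Qed.

Lemma lgN x : x != 0 -> lg (- x) = lg x.
Proof. by move=> x0; rewrite -mulN1r lgM ?oppr_eq0 ?oner_neq0 // lgN1 add0r. Qed.

Lemma lgX x n : x != 0 -> lg (x ^+ n) = lg x *+ n.
Proof.
move=> x0; elim: n => [|n IH]; first by rewrite lg1.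
by rewrite exprS lgM ?expf_neq0 // IH mulrS.
Qed.

Lemma lg_prod (I : finType) (P : pred I) (F : I -> 'F_N) :
  (forall i, P i -> F i != 0) -> lg (\prod_(i | P i) F i) = \sum_(i | P i) lg (F i).
Proof.
move=> F0; suff [] : lg (\prod_(i | P i) F i) = \sum_(i | P i) lg (F i)
  /\ \prod_(i | P i) F i != 0 by [].
apply: (big_rec2 (fun x y => lg x = y /\ x != 0)); first by rewrite lg1 oner_neq0.
by move=> i y x Pi [<- x0]; rewrite lgM ?mulf_neq0 ?F0.
Qed.

Lemma natFp_neq0 n : (0 < n < N)%N -> n%:R != 0 :> 'F_N.
Proof. by move=> /andP[n0 nN]; rewrite Fp_nat_eq0 // gtnNdvd. Qed.

Lemma fact_neq0 n : (n < N)%N -> n`!%:R != 0 :> 'F_N.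
Proof.
elim: n => [|n IH] nN; first by rewrite oner_neq0.
by rewrite factS natrM; apply: mulf_neq0; [apply: natFp_neq0 | apply/IH/ltnW].
Qed.

(** Wilson's theorem gives [n = 0]. Each further step trades a factor [N - 1 - n] for [n + 1], its
    opposite modulo [N], and [lg] ignores signs. *)
Lemma lg_fact_compl n : (n <= N.-1)%N ->
  lg (n`!%:R) + lg ((N.-1 - n)`!%:R) = 0.
Proof.
have N0 := prime_gt0 N_pr; have N1 := prime_gt1 N_pr.
elim: n => [|n IH] nN.
  rewrite lg1 add0r subn0 -lgN ?fact_neq0 ?prednK //.
  have -> : N.-1`!%:R = - 1 :> 'F_N.
    apply/eqP; rewrite -addr_eq0 -[X in _ + X]/(1%:R) -natrD addn1 Fp_nat_eq0 //.
    by rewrite -Wilson.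
  by rewrite opprK lg1.
have := IH (ltnW nN); have -> : (N.-1 - n = (N.-1 - n.+1).+1)%N by lia.
rewrite !factS !natrM !lgM ?fact_neq0 ?natFp_neq0 //; try by lia.
have -> : lg (N.-1 - n.+1).+1%:R = lg n.+1%:R.
  rewrite -[RHS]lgN ?natFp_neq0 //; last by lia.
  congr lg; apply/eqP; rewrite -addr_eq0 -natrD Fp_nat_eq0 //.
  by have -> : ((N.-1 - n.+1).+1 + n.+1 = N)%N by lia.
by move=> <-; rewrite addrCA addrA.
Qed.

Definition lgfact (c : nat) : V := lg ((c * m)`!%:R).

Lemma lgfact_compl (c : nat) : (c <= p)%N -> lgfact (p - c) = - lgfact c.
Proof.
move=> cp; apply/eqP; rewrite -addr_eq0 addrC /lgfact.
have -> : ((p - c) * m)%N = (N.-1 - c * m)%N by rewrite N_eq /= mulnBl.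
by rewrite lg_fact_compl // N_eq /= leq_mul2r cp orbT.
Qed.

Variable r : 'F_N.
Hypothesis r_prim : p.-primitive_root r.
Variable t : 'F_N -> 'F_p.
Hypothesis tE : forall x, x != 0 -> r ^+ (t x) * x ^+ m = 1.

Let m_gt0 := cofactor_gt0 N_pr N_eq.
Let rp := prim_expr_order r_prim.

(** A carry means [(p - a c) m < c m], so the binomial coefficient is 0. *)
Lemma jacobi_residue0 (a c : 'F_p) : a != 0 -> c != 0 ->
  (p < c + (a * c)%R)%N -> ev (r ^+ c) (jacobi t a) = 0.
Proof.
move=> a0 c0 acp; rewrite (jacobi_residue p_pr N_pr N_eq r_prim tE) //.
rewrite bin_small ?mulr0n ?oppr0 // ltn_mul2r m_gt0.
by have := Fp_ltn p_pr (a * c); lia.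
Qed.

(** Without a carry the binomial coefficient is a quotient of factorials of numbers below [N];
    [lgfact_compl] rewrites those of index [p - a c] and [p - c - a c]. *)
Lemma lg_jacobi (a c : 'F_p) : a != 0 -> c != 0 -> (c + (a * c)%R < p)%N ->
  ev (r ^+ c) (jacobi t a) != 0 /\
  lg (ev (r ^+ c) (jacobi t a)) = lgfact ((1 + a) * c)%R - lgfact c - lgfact (a * c)%R.
Proof.
move=> a0 c0 acp; rewrite (jacobi_residue p_pr N_pr N_eq r_prim tE) //.
have val_sum : ((1 + a) * c)%R = (c + (a * c)%R)%N :> nat.
  by rewrite mulrDl mul1r Fp_valD // modn_small.
rewrite val_sum; move: (nat_of_ord (a * c)) acp => d cdp.
set n := ((p - d) * m)%N; set k := (c * m)%N.
have kn : (k <= n)%N by rewrite leq_mul2r; apply/orP; right; lia.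
have nN : (n < N)%N by rewrite N_eq ltnS leq_mul2r leq_subr orbT.
have binE : 'C(n, k)%:R * (k`!%:R * (n - k)`!%:R) = n`!%:R :> 'F_N.
  by rewrite -!natrM bin_fact.
have bin0 : 'C(n, k)%:R != 0 :> 'F_N.
  by apply: contraTneq (fact_neq0 nN) => b0; rewrite -binE b0 mul0r eqxx.
have sign0 : (-1) ^+ k != 0 :> 'F_N by rewrite expf_neq0 // oppr_eq0 oner_neq0.
rewrite -mulr_natr; split; first by rewrite oppr_eq0 mulf_neq0.
rewrite lgN ?mulf_neq0 // lgM // lgX ?oppr_eq0 ?oner_neq0 // lgN1 mul0rn add0r.
have kN := leq_ltn_trans kn nN; have nkN := leq_ltn_trans (leq_subr k n) nN.
have /(congr1 lg) := binE; rewrite !lgM ?mulf_neq0 ?fact_neq0 //.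
rewrite -/(lgfact c) -/(lgfact (p - d)) lgfact_compl; last by lia.
have -> : (n - k = (p - (c + d)) * m)%N by rewrite /n /k -mulnBl; congr (_ * _)%N; lia.
rewrite -/(lgfact (p - (c + d))) lgfact_compl; last by lia.
move=> e; rewrite -[LHS](addrK (lgfact c - lgfact (c + d))) e opprB.
by rewrite addrC addrAC.
Qed.

Variables (L : idomainType) (zeta : L).
Hypothesis zeta_prim : p.-primitive_root zeta.
Hypothesis L_char0 : injective (intr : int -> L).
Hypothesis conj : forall (g : {poly int}) (c : 'F_p), c != 0 ->
  ev zeta g = 0 -> ev (zeta ^+ c) g = 0.
Variable f : {poly int}.
Hypothesis f_norm : \prod_(c : 'F_p | c != 0) ev (zeta ^+ c) f = N%:R.
Hypothesis fr0 : ev r f = 0.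
Hypothesis fr_neq0 : forall c : 'F_p, c != 0 -> c != 1 -> ev (r ^+ c) f != 0.

Variable a : 'F_p.
Hypotheses (a_neq0 : a != 0) (a_neqN1 : a != - 1).

(** The inequality can be strict: for nonzero [c] the sum is never [p], because [a] is not -1 (see
    [carryP]). *)
Definition carry (c : 'F_p) : bool := (p < c + (a * c)%R)%N.

Lemma carryP (c : 'F_p) : c != 0 -> ~~ carry c -> (c + (a * c)%R < p)%N.
Proof.
move=> c0; rewrite /carry -leqNgt leq_eqVlt => /orP[/eqP e|//].
have : (1 + a) * c == 0.
  by rewrite mulrDl mul1r -[X in X + _]natr_Zp -[X in _ + X]natr_Zp -natrD e pchar_Fp_0.
by rewrite mulf_eq0 (negbTE c0) addrC addr_eq0 (negbTE a_neqN1).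
Qed.

(** Negation changes the sum of the two representatives from [s] to [2 p - s]. *)
Lemma carryN (c : 'F_p) : c != 0 -> carry (- c) = ~~ carry c.
Proof.
move=> c0; have ac0 := mulf_neq0 a_neq0 c0.
have := carryP c0; rewrite /carry mulrN !Fp_valN //.
move: (Fp_ltn p_pr c) (Fp_ltn p_pr (a * c)).
move: (nat_of_ord c) (nat_of_ord (a * c)) => c' d' cp dp.
by case: (ltnP p (c' + d')) => [s _|s /(_ isT) s'] /=; lia.
Qed.

(** The factors are the [sigma_d^-1(u)]: the one of index [d] vanishes at [r ^+ d]. *)
Definition conj_prod (P : pred 'F_p) : {poly int} :=
  \prod_(d : 'F_p | (d != 0) && P d) (f \Po 'X^(d^-1 : 'F_p)%R).

Lemma ev_conj_prod (K : comNzRingType) (z : K) P :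
  ev z (conj_prod P) = \prod_(d : 'F_p | (d != 0) && P d) ev (z ^+ (d^-1 : 'F_p)%R) f.
Proof. by rewrite rmorph_prod; apply: eq_bigr => d _; apply: ev_comp. Qed.

Lemma conj_prod_split :
  ev zeta (conj_prod carry) * ev zeta (conj_prod (predC carry)) = N%:R.
Proof.
rewrite -f_norm (reindex_inj invr_inj) /= !ev_conj_prod [RHS](bigID carry) /=.
by congr (_ * _); apply: eq_bigl => d; rewrite invr_eq0.
Qed.

Lemma conj_prod_bar (e : 'F_p) : e = - 1 ->
  ev (zeta ^+ e) (conj_prod carry) = ev zeta (conj_prod (predC carry)).
Proof.
have zp := prim_expr_order zeta_prim.
move=> ->; rewrite !ev_conj_prod (reindex_inj oppr_inj).
apply: eq_big => [d|d _]; last by rewrite -exprFpM // invrN mulrNN mul1r.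
by rewrite oppr_eq0; case: eqVneq => //= d0; rewrite carryN.
Qed.

(** The Jacobi sum times the product over the non-carries vanishes at every [r ^+ c]: the Jacobi sum
    does if [c] carries, the factor of index [c] does otherwise. So [N] divides it, and the Jacobi
    sum is the product over the carries times some [l]. Comparing [jacobi_abs] with [conj_prod_bar]
    gives [l] absolute value 1. *)
Lemma jacobi_factor : exists (b : bool) (k : 'F_p),
  ev zeta (jacobi t a) = ev zeta (conj_prod carry * ((-1) ^+ b * 'X^k)).
Proof.
have zp := prim_expr_order zeta_prim.
have vanish (c : 'F_p) : c != 0 ->
    ev (r ^+ c) (jacobi t a * conj_prod (predC carry)) = 0.
  move=> c0; rewrite rmorphM /=; have [Cc|nCc] := boolP (carry c).
    by rewrite jacobi_residue0 ?mul0r.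
  rewrite ev_conj_prod (bigD1 c) /=; last by rewrite c0.
  by rewrite -exprFpM // mulfV // Fp_val1 // expr1 fr0 mul0r mulr0.
have [l lE] := vanish_mod p_pr N_pr r_prim zeta_prim vanish.
have N0 := N_neq0 N_pr L_char0.
have v0 : ev zeta (conj_prod (predC carry)) != 0.
  by apply: contraNneq N0 => v0; rewrite -conj_prod_split v0 mulr0.
have JE : ev zeta (jacobi t a) = ev zeta (conj_prod carry * l).
  apply: (mulIf v0); move: lE; rewrite !rmorphM /= => ->.
  by rewrite -conj_prod_split mulrAC.
have l_abs : ev zeta l * ev (zeta ^+ (- (1 : 'F_p))%R) l = 1.
  have := jacobi_abs p_pr N_pr N_eq r_prim tE zeta_prim a_neq0 a_neqN1.
  have [e eN1] : exists e : 'F_p, e = - 1 by exists (- 1).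
  rewrite -eN1; have Phi0 : ev (zeta ^+ e) (Phi p) = 0.
    by apply/evPhi0/exprFp_prim; rewrite // eN1 oppr_eq0 oner_neq0.
  rewrite JE (ev_transfer p_pr zeta_prim L_char0 conj Phi0 JE) !rmorphM /=.
  rewrite conj_prod_bar // mulrACA conj_prod_split => e1.
  by apply: (mulfI N0); rewrite e1 mulr1.
have [b [k lE']] := abs1_root_of_unity p_pr zeta_prim L_char0 conj l_abs.
exists b, k; rewrite JE !rmorphM /= lE' evX rmorphXn /=.
by rewrite rmorphN1.
Qed.

(* The value at 1, where sigma_1(u) = u vanishes in the residue field, is the one forced by
   extending lg to N-adic numbers with lg N = 0. *)
Definition conj_lg (e : 'F_p) : V :=
  if e == 1 then - \sum_(d : 'F_p | (d != 0) && (d != 1)) lg (ev (r ^+ d) f)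
  else lg (ev (r ^+ e) f).

Lemma sum_conj_lg : \sum_(e : 'F_p | e != 0) conj_lg e = 0.
Proof.
rewrite (bigD1 1) ?oner_neq0 //= {1}/conj_lg eqxx addrC; apply/eqP.
rewrite subr_eq0; apply/eqP/eq_bigr => d /andP[_ d1].
by rewrite /conj_lg (negbTE d1).
Qed.

(* Both sides are odd in c, so it suffices to treat the c where the Jacobi sum is prime to N. *)
Lemma stickelberger_lg : exists2 lam : V, lam *+ p = 0 & forall c : 'F_p, c != 0 ->
  lgfact ((1 + a) * c)%R - lgfact c - lgfact (a * c)%R
    = \sum_(d : 'F_p | (d != 0) && carry d) conj_lg (c / d) + lam *+ c.
Proof.
have r0 : r != 0.
  by apply/eqP => r0; move: rp; rewrite r0 expr0n gtn_eqF ?prime_gt0 // => /eqP; rewrite eq_sym oner_eq0.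
(* The torsion element is the logarithm of [r ^+ k], the image of the root of unity [zeta ^+ k]; it
   is killed by [p] because [r ^+ p = 1]. *)
have [b [k JE]] := jacobi_factor; have lam_p : lg r *+ k *+ p = 0 by rewrite -mulrnAC -lgX // rp lg1 mul0rn.
exists (lg r *+ k) => //.
have no_carry (c : 'F_p) : c != 0 -> ~~ carry c ->
    lgfact ((1 + a) * c)%R - lgfact c - lgfact (a * c)%R
    = \sum_(d : 'F_p | (d != 0) && carry d) conj_lg (c / d) + lg r *+ k *+ c.
  move=> c0 nCc; have [J0 <-] := lg_jacobi a_neq0 c0 (carryP c0 nCc).
  have Phi0 : ev (r ^+ c) (Phi p) = 0 by apply/evPhi0/exprFp_prim.
  have {}JE := ev_transfer p_pr zeta_prim L_char0 conj Phi0 JE.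
  (* [d] carries and [c] does not, so the exceptional value of [conj_lg] at 1 is not met. *)
  have cd1 (d : 'F_p) : (d != 0) && carry d -> c / d != 1.
    move=> /andP[d0 Cd]; apply: contraNneq nCc => cd.
    by rewrite -(divfK d0 c) cd mul1r.
  move: JE J0; rewrite !rmorphM /= evX rmorphXn /= rmorphN1 ev_conj_prod => ->.
  rewrite !mulf_eq0 !negb_or => /andP[v0 /andP[s0 rk0]].
  rewrite !lgM ?mulf_neq0 // lgX ?oppr_eq0 ?oner_neq0 // lgN1 mul0rn add0r.
  rewrite !lgX ?expf_neq0 // mulrnAC; congr (_ + _).
  rewrite lg_prod => [|d Cd].
    apply: eq_bigr => d Cd; rewrite /conj_lg (negbTE (cd1 d Cd)).
    by rewrite -exprFpM.
  move/andP: (Cd) => [d0 _]; rewrite -exprFpM // fr_neq0 //.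
    by rewrite mulf_neq0 ?invr_eq0.
  exact: cd1.
move=> c c0; have [Cc|] := boolP (carry c); last exact: no_carry.
have nc0 : - c != 0 by rewrite oppr_eq0.
have := no_carry _ nc0; rewrite carryN // Cc => /(_ isT).
have a1c : (1 + a) * c != 0 by rewrite mulf_neq0 // addrC addr_eq0.
have ac : a * c != 0 by rewrite mulf_neq0.
rewrite !mulrN !Fp_valN // !lgfact_compl ?(ltnW (Fp_ltn _ _)) //.
rewrite mulrnBr ?(ltnW (Fp_ltn _ _)) // lam_p add0r.
(* Replacing [d] by [- d] gives the sum over the non-carries, which together with the sum over the
   carries is the full sum of [conj_lg], that is 0. *)
have -> : \sum_(d : 'F_p | (d != 0) && carry d) conj_lg (- c / d)
    = - \sum_(d : 'F_p | (d != 0) && carry d) conj_lg (c / d).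
  apply/eqP; rewrite -addr_eq0 addrC; apply/eqP.
  rewrite -[RHS]sum_conj_lg [RHS](reindex_inj (mulfI c0)) /= [RHS](reindex_inj invr_inj) /=.
  rewrite [RHS](bigID carry) /=; congr (_ + _).
    by apply: eq_bigl => d; rewrite mulf_eq0 invr_eq0 negb_or c0.
  rewrite [LHS](reindex_inj oppr_inj) /=; apply: eq_big => [d|d _].
    rewrite mulf_eq0 invr_eq0 oppr_eq0 negb_or c0 /=.
    by case: eqVneq => //= d0; rewrite carryN.
  by rewrite invrN mulrNN.
by move/(congr1 -%R); rewrite !opprD !opprK.
Qed.
End KeyIdentity.

(** * The sum over residues modulo N *)

Section DigitSums.
Variables (p N m : nat) (p_pr : prime p) (N_pr : prime N).
Hypotheses (N_eq : N = (p * m).+1).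
Variables (R : comNzRingType) (lg : 'F_N -> R).
Hypothesis lgM : forall x y, x != 0 -> y != 0 -> lg (x * y) = lg x + lg y.
Hypothesis lgN1 : lg (- 1) = 0.
Variable psi : 'F_p -> R.
Hypotheses (psi0 : psi 0 = 0) (psi_sum : \sum_c psi c = 0).

Definition psi_sum_lt (k : nat) : R := \sum_(0 <= a < k) psi a%:R.

Lemma psi_sum_ltS k : psi_sum_lt k.+1 = psi_sum_lt k + psi k%:R.
Proof. by rewrite /psi_sum_lt big_nat_recr. Qed.

Lemma psi_sum_lt_p : psi_sum_lt p = 0.
Proof.
rewrite -psi_sum /psi_sum_lt (big_Fp p_pr); apply: eq_bigr => c _.
by rewrite natr_Zp.
Qed.

Lemma psi_sum_lt_period j k : psi_sum_lt (j * p + k) = psi_sum_lt k.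
Proof.
elim: j => // j <-; rewrite mulSn -addnA; move: (j * p + k)%N => n.
elim: n => [|n IH]; first by rewrite addn0 psi_sum_lt_p /psi_sum_lt big_geq.
by rewrite addnS !psi_sum_ltS IH natrD pchar_Fp_0 // add0r.
Qed.

Lemma big_nat_blocks (K : nat -> R) n :
  \sum_(0 <= k < n * p) K k = \sum_(0 <= j < n) \sum_(0 <= i < p) K (j * p + i)%N.
Proof.
elim: n => [|n IH]; first by rewrite !big_geq.
rewrite big_nat_recr //= -IH mulSn addnC (big_cat_nat _ (leq_addr p _)) //=.
congr (_ + _); rewrite -{1}[(n * p)%N]add0n big_addn addKn.
by apply: eq_bigr => i _; rewrite addnC.
Qed.

Lemma lg_fact_ratio A n : (A + n < N)%N ->
  \sum_(0 <= j < n) lg (A + n - j)%:R = lg (A + n)`!%:R - lg A`!%:R.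
Proof.
elim: n => [|n IH] An; first by rewrite big_geq // addn0 subrr.
rewrite big_nat_recl // subn0 (eq_bigr (fun j => lg (A + n - j)%:R)) => [|j _]; last first.
  by rewrite addnS subSS.
rewrite addnS in An *.
rewrite IH ?(ltnW An) // factS natrM lgM ?addrA //; first exact: natFp_neq0.
by apply: fact_neq0; rewrite ?(ltnW An).
Qed.

Lemma abel_summation (g : nat -> R) n :
  \sum_(0 <= i < n) psi_sum_lt i.+1 * (g i.+1 - g i)
    = psi_sum_lt n * g n - \sum_(0 <= i < n) psi i%:R * g i.
Proof.
elim: n => [|n IH]; first by rewrite !big_geq // /psi_sum_lt big_geq // mul0r subrr.
by rewrite !big_nat_recr //= IH psi_sum_ltS; ring.
Qed.

Lemma psi_sum_lt_sum n :
  \sum_(0 <= i < n) psi_sum_lt i.+1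
    = n%:R * psi_sum_lt n - \sum_(0 <= a < n) a%:R * psi a%:R.
Proof.
elim: n => [|n IH]; first by rewrite !big_geq // mul0r subrr.
by rewrite !big_nat_recr //= IH psi_sum_ltS; ring.
Qed.

(* (j p + i + 1) = - p ((i + 1) m - j) modulo N, since p m = -1. *)
Lemma lg_block i j : (i < p)%N -> (j < m)%N ->
  lg (j * p + i).+1%:R = lg p%:R + lg (i * m + m - j)%:R.
Proof.
move=> ip jm; have m_gt0 := cofactor_gt0 N_pr N_eq.
have p_gt1 := prime_gt1 p_pr.
have pN0 : p%:R != 0 :> 'F_N by rewrite natFp_neq0 // N_eq; nia.
have bnd : (i * m + m - j < N)%N by rewrite N_eq; nia.
have q0 : (i * m + m - j)%:R != 0 :> 'F_N by rewrite natFp_neq0 // bnd andbT; nia.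
rewrite -lgM // -[RHS]lgN ?mulf_neq0 //; congr lg.
apply/eqP; rewrite -natrM -addr_eq0 -natrD Fp_nat_eq0 //.
have -> : ((j * p + i).+1 + p * (i * m + m - j) = i.+1 * N)%N by rewrite N_eq; nia.
exact: dvdn_mull.
Qed.

(** For [k = j p + i + 1], [lg_block] and periodicity turn the sum over [j] into [psi_sum_lt i.+1]
    times the increment of [lgfact] at [i] plus [m lg(p)]. The increments are summed by parts; the
    [lg(p)] part is a multiple of the weighted sum assumed to be 0. *)
Lemma log_sum :
    m%:R * \sum_(0 <= a < p) a%:R * psi a%:R = 0 ->
  \sum_(1 <= k < N) psi_sum_lt k * lg k%:R = - \sum_c psi c * lgfact m lg c.
Proof.
move=> weighted0.
rewrite [X in index_iota 1 X]N_eq big_add1 /= mulnC big_nat_blocks exchange_big_nat /=.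
have blockE i : (i < p)%N ->
    \sum_(0 <= j < m) psi_sum_lt (j * p + i).+1 * lg (j * p + i).+1%:R
    = psi_sum_lt i.+1 * (lgfact m lg i.+1 - lgfact m lg i) + m%:R * lg p%:R * psi_sum_lt i.+1.
  move=> ip.
  rewrite (eq_big_nat _ _ (F2 := fun j => psi_sum_lt i.+1 * (lg p%:R + lg (i * m + m - j)%:R))); last first.
    by move=> j /andP[_ jm]; rewrite lg_block // -addnS psi_sum_lt_period.
  rewrite -mulr_sumr big_split /= lg_fact_ratio; last first.
    by rewrite N_eq; nia.
  rewrite sumr_const_nat subn0 /lgfact -mulSnr -mulr_natl; ring.
rewrite (eq_big_nat _ _ (fun i ip => blockE i (proj2 (andP ip)))).
rewrite big_split /= -mulr_sumr abel_summation psi_sum_lt_sum psi_sum_lt_p.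
rewrite mul0r mulr0 !sub0r mulrN mulrAC weighted0 mul0r oppr0 addr0.
rewrite (big_Fp p_pr); congr (- _); apply: eq_bigr => c _.
by rewrite natr_Zp.
Qed.
End DigitSums.

Lemma unit_ext_val (R : finUnitRingType) (V : zmodType) (f : {unit R} -> V) (v : {unit R}) :
  unit_ext f (val v) = f v.
Proof. by rewrite /unit_ext valK. Qed.

Lemma Fp_unit_val p (p_pr : prime p) (x : 'F_p) :
  x != 0 -> exists v : {unit 'F_p}, x = val v.
Proof. by rewrite -unitfE => x0; exists (Sub x x0); rewrite SubK. Qed.

Lemma unit_ext0 p (p_pr : prime p) (V : zmodType) (f : {unit 'F_p} -> V) :
  unit_ext f 0 = 0.
Proof. by rewrite /unit_ext insubF // unitr0. Qed.

Lemma unit_ext_morph p (p_pr : prime p) (V : zmodType) (f : {unit 'F_p} -> V) :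
  (forall x y, f (x * y)%g = f x + f y) ->
  forall x y, x != 0 -> y != 0 -> unit_ext f (x * y) = unit_ext f x + unit_ext f y.
Proof.
move=> fM x y /(Fp_unit_val p_pr)[v ->] /(Fp_unit_val p_pr)[w ->].
by rewrite -[val v * val w]/(val (v * w)%g) !unit_ext_val fM.
Qed.

(** * The character and its Bernoulli number *)

Section PadicReduction.
Variables (p : nat) (p_pr : prime p).
Local Notation Zp := (padic_int p_pr).

Definition padic_red (n : nat) (x : Zp) : 'Z_(p ^ n.+1) := x n.

Fact padic_red_zmod n : zmod_morphism (padic_red n).
Proof. by []. Qed.
Fact padic_red_monoid n : monoid_morphism (padic_red n).
Proof. by []. Qed.
HB.instance Definition _ n :=
  GRing.isZmodMorphism.Build Zp 'Z_(p ^ n.+1) (padic_red n) (padic_red_zmod n).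
HB.instance Definition _ n :=
  GRing.isMonoidMorphism.Build Zp 'Z_(p ^ n.+1) (padic_red n) (padic_red_monoid n).

Lemma padic_modE n (x : Zp) : padic_mod n.+1 x = padic_red n x.
Proof. exact: padic_coordP. Qed.

Lemma padic_red_unit n (x : Zp) : padic_red 0 x != 0 -> padic_red n x \is a GRing.unit.
Proof.
move=> x0; have := @padic_ndvd _ p_pr _ 0 n x0; rewrite add0n expn1 => ndvd.
rewrite [padic_red n x]padic_natz unitZpE ?padic_gt1 //.
by rewrite coprimeXl // prime_coprime.
Qed.

Lemma padic_nat_neq0 k : (0 < k)%N -> k%:R != 0 :> Zp.
Proof.
move=> k0; apply/eqP => /(congr1 (padic_red k)); rewrite rmorph_nat rmorph0.
move/(congr1 (@nat_of_ord _)); rewrite val_Zp_nat ?padic_gt1 //= => /eqP.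
rewrite -/(dvdn _ _) gtnNdvd // (leq_trans (ltn_expl k (prime_gt1 p_pr))) //.
by rewrite leq_exp2l ?prime_gt1.
Qed.

Lemma red0_p : p%:R = 0 :> 'Z_(p ^ 1).
Proof. by apply: ord_inj; rewrite val_Zp_nat ?padic_gt1 // expn1 modnn. Qed.

Lemma red0_nat_mod a b : a = b %[mod p] -> a%:R = b%:R :> 'Z_(p ^ 1).
Proof. by move=> ab; apply: ord_inj; rewrite !val_Zp_nat ?padic_gt1 // expn1 ab. Qed.

Variable chi : {unit 'F_p} -> Zp.
Hypothesis chiP : padic_character chi.
Hypothesis chi_odd : unit_ext chi (-1) = -1.

Definition psi (c : 'F_p) : Zp := unit_ext (fun x => (chi x)^-1) c.

Lemma psi0 : psi 0 = 0.
Proof. exact: unit_ext0. Qed.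

Lemma psiM x y : psi (x * y) = psi x * psi y.
Proof.
have [->|x0] := eqVneq x 0; first by rewrite mul0r psi0 mul0r.
have [->|y0] := eqVneq y 0; first by rewrite mulr0 psi0 mulr0.
have [v ->] := Fp_unit_val p_pr x0; have [w ->] := Fp_unit_val p_pr y0.
rewrite -[val v * val w]/(val (v * w)%g) /psi !unit_ext_val.
by case: chiP => chi_unit ->; rewrite invrM // mulrC.
Qed.

Lemma psi1 : psi 1 = 1.
Proof.
rewrite -[1 in LHS]/(val (1%g : {unit 'F_p})) /psi unit_ext_val.
have [chi_unit chiM] := chiP.
suff -> : chi 1%g = 1 by rewrite invr1.
by apply: (mulrI (chi_unit 1%g)); rewrite -chiM mulg1 mulr1.
Qed.

Lemma psiN x : psi (- x) = - psi x.
Proof.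
rewrite -mulN1r psiM -[RHS]mulN1r; congr (_ * _).
have [|v vE] := Fp_unit_val p_pr (_ : -1 != 0); first by rewrite oppr_eq0 oner_neq0.
by move: chi_odd; rewrite /psi !vE !unit_ext_val => ->; rewrite invrN invr1.
Qed.

Lemma psi_sum0 : \sum_c psi c = 0.
Proof.
have : \sum_c psi c *+ 2 = 0.
  under eq_bigr => c _ do rewrite mulr2n.
  rewrite big_split /= [X in X + _](reindex_inj oppr_inj) /= -big_split /=.
  by rewrite big1 // => c _; rewrite psiN addNr.
rewrite sumrMnl -mulr_natl => /eqP; rewrite mulf_eq0.
by rewrite (negbTE (padic_nat_neq0 _)) // => /eqP.
Qed.

Variable B : Zp.
Hypothesis BE : FracField.tofrac B = bernoulli1_inv chi.

Lemma weighted_sum : \sum_(c : 'F_p) (c : nat)%:R * psi c = p%:R * B.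
Proof.
have p0 : FracField.tofrac (p%:R : Zp) != 0.
  by rewrite tofrac_eq0 padic_nat_neq0 ?prime_gt0.
apply/eqP; rewrite -tofrac_eq rmorphM /= BE /bernoulli1_inv mulrA.
rewrite -(rmorph_nat (@FracField.tofrac Zp) p) mulfV // mul1r.
have -> : \sum_(c : 'F_p) (c : nat)%:R * psi c = \sum_(0 <= a < p) a%:R * psi a%:R.
  by rewrite (big_Fp p_pr); apply: eq_bigr => c _; rewrite natr_Zp.
rewrite big_ltn ?prime_gt0 // mul0r add0r rmorph_sum /=.
by apply/eqP; apply: eq_bigr => a _; rewrite rmorphM rmorph_nat.
Qed.

(* Otherwise chi would reduce to a |-> a modulo p, and p B would be -1 modulo p. *)
Lemma exists_unit_twist : exists a : 'F_p,
  [/\ a != 0, a != - 1 & padic_red 0 (1 + psi a^-1 - psi (1 + a)^-1) != 0].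
Proof.
have [/existsP[a /and3P[]]|] := boolP [exists a : 'F_p, [&& a != 0, a != - 1 &
    padic_red 0 (1 + psi a^-1 - psi (1 + a)^-1) != 0]]; first by exists a.
rewrite negb_exists => /forallP all0.
have step (a : 'F_p) : a != 0 -> a != - 1 ->
    padic_red 0 (psi (1 + a)^-1) = 1 + padic_red 0 (psi a^-1).
  move=> a_0 a_N1; have := all0 a; rewrite a_0 a_N1 negbK rmorphB rmorphD rmorph1 /=.
  by rewrite subr_eq0 => /eqP.
(* As [psi x^-1] is [chi x], this deduces [chi k = k] modulo [p] from [chi (1 + a) = 1 + chi a] by
   induction. *)
have redE k : (k.+1 < p)%N -> padic_red 0 (psi (k.+1%:R)^-1) = k.+1%:R.
  elim: k => [|k IH] kp; first by rewrite invr1 psi1 rmorph1.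
  have k0 : k.+1%:R != 0 :> 'F_p by rewrite Fp_nat_eq0 // gtnNdvd // ltnW.
  have kN1 : k.+1%:R != - 1 :> 'F_p.
    by rewrite -addr_eq0 natr1 Fp_nat_eq0 // gtnNdvd.
  have -> : k.+2%:R = 1 + k.+1%:R :> 'F_p by rewrite nat1r.
  by rewrite step // IH ?(ltnW kp) // nat1r.
have redV (c : 'F_p) : c != 0 -> padic_red 0 ((c : nat)%:R * psi c) = 1.
  move=> c0; rewrite rmorphM rmorph_nat /=.
  have cV0 : c^-1 != 0 by rewrite invr_eq0.
  have := redE (c^-1 : 'F_p).-1; rewrite prednK ?Fp_val_gt0 // natr_Zp invrK.
  move=> /(_ (Fp_ltn p_pr _)) ->; rewrite -natrM -[RHS]/(1%:R); apply: red0_nat_mod.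
  by rewrite -Fp_valM // mulfV // Fp_val1 // modn_small ?prime_gt1.
(* The [p - 1] terms [c psi(c)] are all 1 modulo [p], while [p B] is 0. *)
have := weighted_sum; rewrite (bigD1 0) //= mul0r add0r => /(congr1 (padic_red 0)).
rewrite rmorph_sum (eq_bigr _ redV) sumr_const cardC1.
rewrite card_Fp // rmorphM rmorph_nat /= red0_p mul0r => pred0.
have : p.-1.+1%:R = 0 :> 'Z_(p ^ 1) by rewrite prednK ?prime_gt0 ?red0_p.
by rewrite -natr1 [X in X + 1]pred0 add0r => /eqP; rewrite oner_eq0.
Qed.
End PadicReduction.
Arguments padic_red : simpl never.

(** * Summation of the logarithmic relation against the character *)

Section Combination.
Variables (p : nat) (p_pr : prime p).
Local Notation Zp := (padic_int p_pr).
Variable chi : {unit 'F_p} -> Zp.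
Hypothesis chiP : padic_character chi.
Hypothesis chi_odd : unit_ext chi (-1) = -1.
Variable B : Zp.
Hypothesis BE : FracField.tofrac B = bernoulli1_inv chi.

(** [act] is the multiplication of [Z_p] in [sum_carry], and its action on [Z/p^(n+1)] in
    [log_conjugates]. *)
Lemma sum_psi_scale (V : zmodType) (act : Zp -> V -> V) (b : 'F_p) (h : nat -> V) : b != 0 ->
  \sum_(c : 'F_p) act (psi chi c) (h (b * c)%R)
    = \sum_(c : 'F_p) act (psi chi b^-1 * psi chi c) (h c).
Proof.
move=> b0; rewrite [RHS](reindex_inj (mulfI b0)); apply: eq_bigr => c _.
by rewrite -psiM // mulKf.
Qed.

Lemma carryE (a c : 'F_p) : c != 0 -> a != - 1 ->
  (c + (a * c)%R = ((1 + a) * c)%R + p * carry a c)%N.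
Proof.
move=> c0 aN1; have := carryP p_pr aN1 c0.
rewrite mulrDl mul1r Fp_valD // /carry.
have := Fp_ltn p_pr c; have := Fp_ltn p_pr (a * c).
move: (nat_of_ord c) (nat_of_ord (a * c)) => c' d' cp dp.
case: ltnP => [lt_p _|_ /(_ isT) lt_p]; last by rewrite modn_small // muln0 addn0.
rewrite muln1 -[in RHS](subnK (ltnW lt_p)) modnDr modn_small //; lia.
Qed.

(** By [carryE], [p] times the indicator of a carry is a combination of the representatives of [d],
    [a d] and [(1 + a) d]. Weighted by [psi], these sum to [p B] times values of [psi], and [p]
    cancels. *)
Lemma sum_carry (a : 'F_p) : a != 0 -> a != - 1 ->
  \sum_(d : 'F_p | (d != 0) && carry a d) psi chi d
    = B * (1 + psi chi a^-1 - psi chi (1 + a)^-1).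
Proof.
move=> a0 aN1; have p0 : p%:R != 0 :> Zp by rewrite padic_nat_neq0 ?prime_gt0.
have a10 : 1 + a != 0 by rewrite addrC addr_eq0.
have scaled (b : 'F_p) : b != 0 ->
    \sum_(c : 'F_p) psi chi c * ((b * c)%R : nat)%:R = psi chi b^-1 * (p%:R * B).
  move=> b0; rewrite (sum_psi_scale *%R (fun n => n%:R) b0).
  rewrite -(weighted_sum BE) mulr_sumr; apply: eq_bigr => c _.
  by rewrite -mulrA [psi chi c * _]mulrC.
apply: (mulfI p0); rewrite mulrA mulrBr mulrDr mulr1.
rewrite [_ * psi chi a^-1]mulrC [_ * psi chi (1 + a)^-1]mulrC -!scaled //.
rewrite -[p%:R * B](weighted_sum BE) -big_split -sumrB big_mkcond mulr_sumr /=.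
apply: eq_bigr => d _; have [->|d0] /= := eqVneq d 0.
  by rewrite psi0 !mulr0 !mul0r addr0 subrr.
have /(congr1 (fun n => n%:R : Zp)) := carryE d0 aN1.
rewrite !natrD natrM => dE.
rewrite [_ * psi chi d]mulrC -mulrDr -mulrBr dE addrAC subrr add0r.
by case: carry; rewrite ?mulr0 // mulr1 mulrC.
Qed.

Variables (N m : nat) (N_pr : prime N) (N_eq : N = (p * m).+1) (n : nat).
Variable lg : 'F_N -> 'Z_(p ^ n.+1).
Hypothesis lgM : forall x y, x != 0 -> y != 0 -> lg (x * y) = lg x + lg y.
Hypothesis lgN1 : lg (- 1) = 0.
Variable r : 'F_N.
Hypothesis r_prim : p.-primitive_root r.
Variables (L : idomainType) (zeta : L).
Hypothesis zeta_prim : p.-primitive_root zeta.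
Hypothesis L_char0 : injective (intr : int -> L).
Hypothesis conj : forall (g : {poly int}) (c : 'F_p), c != 0 ->
  ev zeta g = 0 -> ev (zeta ^+ c) g = 0.
Variable f : {poly int}.
Hypothesis f_norm : \prod_(c : 'F_p | c != 0) ev (zeta ^+ c) f = N%:R.
Hypothesis fr0 : ev r f = 0.
Hypothesis fr_neq0 : forall c : 'F_p, c != 0 -> c != 1 -> ev (r ^+ c) f != 0.

Let psi_n (c : 'F_p) := padic_red n (psi chi c).

Lemma log_conjugates : B \is a GRing.unit ->
  \sum_(e : 'F_p | e != 0) psi_n e * conj_lg lg r f e
    = padic_red n B^-1 * - \sum_c psi_n c * lgfact m lg c.
Proof.
move=> B_unit; have [a [a0 aN1 twist]] := exists_unit_twist chiP BE.
have [t tE] := exists_index p_pr N_pr N_eq r_prim.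
have [lam lam_p lgE] := stickelberger_lg p_pr N_pr N_eq lgM lgN1 r_prim tE
  zeta_prim L_char0 conj f_norm fr0 fr_neq0 a0 aN1.
have a10 : 1 + a != 0 by rewrite addrC addr_eq0.
set S := \sum_c _ * lgfact _ _ _; set X := \sum_(e | _) _.
set U := 1 + _ - _ in twist; have U_unit := padic_red_unit n twist.
have scaled (b : 'F_p) : b != 0 ->
    \sum_(c : 'F_p) psi_n c * lgfact m lg (b * c)%R = padic_red n (psi chi b^-1) * S.
  move=> b0; rewrite (sum_psi_scale (fun x v => padic_red n x * v) (lgfact m lg) b0).
  by rewrite mulr_sumr; apply: eq_bigr => c _; rewrite rmorphM mulrA.
have lhsE : \sum_c psi_n c * (lgfact m lg ((1 + a) * c)%R - lgfact m lg c - lgfact m lg (a * c)%R)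
    = - (padic_red n U * S).
  under eq_bigr => c _ do rewrite !mulrBr.
  rewrite !sumrB !scaled // -/S /U rmorphB rmorphD rmorph1 /=; ring.
(* The weighted sum is [p B], and [p] kills [lam]. *)
have lamE : \sum_c psi_n c * (lam *+ c) = 0.
  have -> : \sum_c psi_n c * (lam *+ c) = lam * padic_red n (\sum_(c : 'F_p) (c : nat)%:R * psi chi c).
    rewrite rmorph_sum mulr_sumr; apply: eq_bigr => c _.
    by rewrite /= rmorphM rmorph_nat -mulr_natl /psi_n /=; ring.
  by rewrite (weighted_sum BE) rmorphM rmorph_nat /= mulrA mulr_natr lam_p mul0r.
(* The substitution [c = d e] separates the double sum. *)
have convE : \sum_(c : 'F_p | c != 0) psi_n c *
      \sum_(d : 'F_p | (d != 0) && carry a d) conj_lg lg r f (c / d)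
    = padic_red n (B * U) * X.
  rewrite -sum_carry // rmorph_sum mulr_suml.
  under eq_bigr => c _ do rewrite mulr_sumr.
  rewrite exchange_big; apply: eq_bigr => d /andP[d0 _].
  rewrite (reindex_inj (mulfI d0)) mulr_sumr; apply: eq_big => [e|e _].
    by rewrite mulf_eq0 negb_or d0.
  by rewrite /psi_n psiM // rmorphM mulrA [d * e]mulrC mulfK.
have psi_n0 : psi_n 0 = 0 by rewrite /psi_n psi0 rmorph0.
have key : - (padic_red n U * S) = padic_red n (B * U) * X.
  rewrite -lhsE -convE -[RHS]addr0 -[X in _ = _ + X]lamE.
  rewrite (bigD1 0) //= psi_n0 mul0r add0r [X in _ = _ + X](bigD1 0) //= psi_n0 mul0r add0r.
  rewrite -big_split /=; apply: eq_bigr => c c0.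
  by rewrite lgE // mulrDr.
apply: (mulrI U_unit); apply: (mulrI (_ : padic_red n B \is a GRing.unit)).
  by rewrite rmorph_unit.
have BV : padic_red n B * padic_red n B^-1 = 1 by rewrite -rmorphM divrr ?rmorph1.
rewrite mulrA -rmorphM -key.
transitivity ((padic_red n B * padic_red n B^-1) * - (padic_red n U * S)); last by ring.
by rewrite BV mul1r.
Qed.
End Combination.

(** * Galois conjugates *)

Section GaloisConjugates.
Variables (p : nat) (p_pr : prime p).
Variables (L : splittingFieldType rat) (zeta : L).
Hypotheses (zeta_prim : p.-primitive_root zeta) (zeta_gen : <<1; zeta>>%VS = {:L}%VS).
Variable sigma : nat -> gal_of {:L}.
Hypothesis sigmaE : forall a, ~~ (p %| a)%N ->
  sigma a \in ('Gal({:L} / 1))%g /\ sigma a zeta = zeta ^+ a.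

Lemma Fp_ndvd (c : 'F_p) : c != 0 -> ~~ (p %| c)%N.
Proof. by move=> c0; rewrite -(Fp_nat_eq0 p_pr) natr_Zp. Qed.

(** [E] is a variable so that its equality with [<<1; zeta>>] can be eliminated inside the dependent
    type [gal_of E]. *)
Lemma gal_eq_gen (E : {subfield L}) : <<1; zeta>>%AS = E ->
  forall x y : gal_of E, x \in ('Gal(E / 1))%g -> y \in ('Gal(E / 1))%g ->
  x zeta = y zeta -> x = y.
Proof.
by case: E / => x y x_gal y_gal xy; apply/eqP; rewrite (gal_adjoin_eq x_gal y_gal) xy.
Qed.

Lemma sigma_ev a g : ~~ (p %| a)%N -> sigma a (ev zeta g) = ev (zeta ^+ a) g.
Proof. by move=> /sigmaE[_ <-]; rewrite ev_rmorph. Qed.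

Lemma ev_conj (g : {poly int}) (c : 'F_p) : c != 0 ->
  ev zeta g = 0 -> ev (zeta ^+ c) g = 0.
Proof. by move=> /Fp_ndvd c0 g0; rewrite -sigma_ev // g0 rmorph0. Qed.

(** An automorphism is determined by the image of [zeta], a [p]-th root of unity other than 1, so
    the [sigma c] enumerate the Galois group. *)
Lemma galNorm_conj u : galNorm 1 {:L} u = \prod_(c : 'F_p | c != 0) sigma (c : nat) u.
Proof.
have zp := prim_expr_order zeta_prim.
have galE : 'Gal({:L} / 1)%g = [set sigma (c : 'F_p) | c in predC1 (0 : 'F_p)].
  apply/setP => x; apply/idP/imsetP => [x_gal|[c]]; last first.
    by rewrite inE => /Fp_ndvd/sigmaE[? _] ->.
  have [|i iE] := prim_rootP zeta_prim (_ : (x zeta) ^+ p = 1).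
    by rewrite -rmorphXn zp rmorph1.
  have i0 : (i : nat)%:R != 0 :> 'F_p.
    apply: contraTneq (prime_gt1 p_pr) => i0; rewrite -leqNgt.
    have := exprFp_nat p_pr zp i; rewrite i0 -iE expr0 -(rmorph1 x) => /fmorph_inj z1.
    by rewrite dvdn_leq // (prim_order_dvd zeta_prim) expr1 z1.
  exists (i : nat)%:R; first by rewrite inE.
  have [s_gal s_zeta] := sigmaE (Fp_ndvd i0).
  apply: (gal_eq_gen _ x_gal s_gal); first exact: val_inj.
  by rewrite s_zeta exprFp_nat.
rewrite /galNorm galE big_imset /= => [|c d]; first by apply: eq_bigl => c; rewrite inE.
rewrite !inE => /Fp_ndvd/sigmaE[_ cE] /Fp_ndvd/sigmaE[_ dE] cd.
by apply: (exprFp_inj p_pr zeta_prim); rewrite /= -cE -dE cd.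
Qed.
End GaloisConjugates.

(** * The congruence modulo a power of [p] *)

Lemma two_torsion0 p n (x : 'Z_(p ^ n.+1)) : prime p -> (2 < p)%N -> x *+ 2 = 0 -> x = 0.
Proof.
move=> p_pr p_gt2 x2.
have xq : x *+ (p ^ n.+1) = 0 by rewrite -mulr_natr pchar_Zp ?padic_gt1 // mulr0.
have odd_q : odd (p ^ n.+1).
  by rewrite oddX; apply: contraLR p_gt2; move/(prime_oddPn p_pr) => ->.
move: xq; rewrite -[X in x *+ X]odd_double_half odd_q -muln2 mulnC mulrnDr.
by rewrite mulrnA x2 mul0rn addr0.
Qed.

(** With [nu = n + 1], reduction modulo [p^nu] is the ring morphism [padic_red n]. *)
Lemma mainTheorem3_succ
  (p N n : nat) (p_pr : prime p) (N_pr : prime N)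
  (p_ge5 : (5 <= p)%N)
  (N_mod_p : N = 1 %[mod p]) (nE : n.+1 = logn p (N - 1))
  (log : {unit 'F_N} -> 'Z_(p ^ n.+1))
  (logM : forall x y, log (x * y)%g = log x + log y)
  (L : splittingFieldType rat) (zeta : L)
  (zeta_prim : p.-primitive_root zeta) (zeta_gen : <<1; zeta>>%VS = {:L}%VS)
  (sigma : nat -> gal_of {:L})
  (sigmaE : forall a, ~~ (p %| a)%N ->
     sigma a \in ('Gal({:L} / 1))%g /\ sigma a zeta = zeta ^+ a)
  (u : L) (u_int : int_adjoin zeta u) (u_norm : galNorm 1 {:L} u = N%:R)
  (chi : {unit 'F_p} -> padic_int p_pr) (chiP : padic_character chi)
  (chi_odd : unit_ext chi (-1) = -1)
  (B : padic_int p_pr) (BE : FracField.tofrac B = bernoulli1_inv chi)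
  (B_unit : B \is a GRing.unit) :
  \sum_(2 <= a < p) padic_mod n.+1 (char_inv chi a - 1)
     * unit_ext log (residue_class zeta N u (sigma a u))
  = padic_mod n.+1 B^-1
     * \sum_(1 <= k < N) padic_mod n.+1 (\sum_(1 <= a < k) char_inv chi a)
         * unit_ext log (k%:R : 'F_N).
Proof.
pose m := ((N - 1) %/ p)%N; have p_gt0 := prime_gt0 p_pr; have N_gt0 := prime_gt0 N_pr.
have N_eq : N = (p * m).+1.
  have : (p %| N - 1)%N by rewrite -eqn_mod_dvd //; apply/eqP.
  by move/divnK; rewrite -/m; lia.
have [f uE] := u_int; rewrite -/(ev zeta f) in uE; subst u.
have L_char0 : injective (intr : int -> L).
  move=> x y; rewrite -!(rmorph_int (in_alg L)) => /fmorph_inj; exact: intr_inj.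
have conj := ev_conj p_pr sigmaE.
have f_norm : \prod_(c : 'F_p | c != 0) ev (zeta ^+ c) f = N%:R.
  rewrite -u_norm (galNorm_conj p_pr zeta_prim zeta_gen sigmaE).
  by apply: eq_bigr => c /(Fp_ndvd p_pr) c0; rewrite (sigma_ev sigmaE).
have [r [r_prim fr0 fr_neq0]] := exists_residue_root p_pr N_pr N_eq zeta_prim L_char0 conj f_norm.
pose lg := unit_ext log; have lgM := unit_ext_morph N_pr logM.
have lgN1 : lg (- 1) = 0.
  apply: (two_torsion0 p_pr); first exact: leq_trans p_ge5.
  have lg1 : lg 1 = 0.
    by apply: (addrI (lg 1)); rewrite /lg -lgM ?oner_neq0 // mulr1 addr0.
  by rewrite mulr2n /lg -lgM ?oppr_eq0 ?oner_neq0 // mulrNN mulr1.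
pose psi_n (c : 'F_p) := padic_red n (psi chi c).
(* The sum is [p B], and [m p = N - 1] is divisible by [p^(n+1)]. *)
have weighted : m%:R * \sum_(0 <= a < p) a%:R * psi_n a%:R = 0.
  rewrite (big_Fp p_pr _ (fun a => a%:R * psi_n a%:R)).
  have -> : \sum_(c : 'F_p) (c : nat)%:R * psi_n (c : nat)%:R
      = padic_red n (\sum_(c : 'F_p) (c : nat)%:R * psi chi c).
    by rewrite rmorph_sum; apply: eq_bigr => c _; rewrite natr_Zp rmorphM rmorph_nat.
  rewrite (weighted_sum BE) rmorphM rmorph_nat mulrA -natrM.
  have /dvdnP[q qE] : (p ^ n.+1 %| N - 1)%N by rewrite nE pfactor_dvdnn.
  have -> : (m * p = q * p ^ n.+1)%N by rewrite -qE; lia.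
  by rewrite natrM [X in _ * X * _](_ : _ = 0) ?mulr0 ?mul0r // pchar_Zp ?padic_gt1.
have psi_n0 : psi_n 0 = 0 by rewrite /psi_n psi0 rmorph0.
have psi_n_sum : \sum_c psi_n c = 0.
  transitivity (padic_red n (\sum_c psi chi c)); first by rewrite rmorph_sum.
  by rewrite psi_sum0 // rmorph0.
have rhsE : \sum_(1 <= k < N) padic_mod n.+1 (\sum_(1 <= a < k) char_inv chi a) * lg k%:R
    = - \sum_c psi_n c * lgfact m lg c.
  rewrite -(log_sum p_pr N_pr N_eq lgM lgN1 psi_n_sum weighted).
  apply: eq_big_nat => k /andP[k_gt0 _]; congr (_ * _).
  (* [psi_sum_lt] starts at 0, where [psi_n] vanishes. *)
  rewrite padic_modE rmorph_sum /psi_sum_lt [RHS]big_ltn // psi_n0 add0r.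
  by [].
rewrite rhsE padic_modE -(log_conjugates chiP BE N_pr N_eq lgM lgN1 r_prim
  zeta_prim L_char0 conj f_norm fr0 fr_neq0 B_unit).
have lhsE (a : nat) : (2 <= a < p)%N ->
    padic_mod n.+1 (char_inv chi a - 1) * lg (residue_class zeta N (ev zeta f) (sigma a (ev zeta f)))
    = (psi_n a%:R - 1) * lg (ev (r ^+ a) f).
  move=> /andP[a2 ap]; have a_ndvd : ~~ (p %| a)%N by rewrite gtnNdvd // (leq_trans _ a2).
  rewrite padic_modE rmorphB rmorph1; congr (_ * lg _).
  rewrite (sigma_ev sigmaE) // -ev_comp.
  by rewrite (residue_classE p_pr N_pr zeta_prim L_char0 conj f_norm r_prim fr0) ev_comp.
rewrite (eq_big_nat _ _ lhsE).
have sum_val (F : 'F_p -> 'Z_(p ^ n.+1)) : \sum_(2 <= a < p) F a%:R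
    = \sum_(e : 'F_p | (e != 0) && (e != 1)) F e.
  have p1 := prime_gt1 p_pr.
  have : \sum_(0 <= a < p) F a%:R = \sum_e F e.
    by rewrite (big_Fp p_pr _ (fun a => F a%:R)); apply: eq_bigr => e _; rewrite natr_Zp.
  rewrite big_ltn // big_ltn // (bigD1 0) //= (bigD1 1) ?oner_neq0 //=.
  by move=> /addrI/addrI.
pose G (e : 'F_p) := (psi_n e - 1) * lg (ev (r ^+ e) f).
have -> : \sum_(2 <= a < p) (psi_n a%:R - 1) * lg (ev (r ^+ a) f) = \sum_(2 <= a < p) G a%:R.
  by apply: eq_bigr => a _; rewrite /G exprFp_nat // (prim_expr_order r_prim).
(* The term [e = 1], where [psi] is 1, is minus the sum of the other logarithms; this produces the
   factors [psi_n e - 1]. *)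
rewrite sum_val [RHS](bigD1 1) ?oner_neq0 //= {1}/conj_lg eqxx /psi_n psi1 // rmorph1 mul1r.
rewrite addrC -sumrB; apply: eq_bigr => e /andP[_ e1].
by rewrite /conj_lg (negbTE e1) /G mulrBl mul1r.
Qed.

Theorem mainTheorem3
  (p N nu : nat) (p_pr : prime p) (N_pr : prime N)
  (p_ge5 : (5 <= p)%N) (N_ge5 : (5 <= N)%N)
  (N_mod_p : N = 1 %[mod p]) (nuE : nu = logn p (N - 1))
  (log : {unit 'F_N} -> 'Z_(p ^ nu))
  (logM : forall x y, log (x * y)%g = log x + log y)
  (log_surj : forall t, exists x, log x = t)
  (L : splittingFieldType rat) (zeta : L)
  (zeta_prim : p.-primitive_root zeta) (zeta_gen : <<1; zeta>>%VS = {:L}%VS)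
  (sigma : nat -> gal_of {:L})
  (sigmaE : forall a, ~~ (p %| a)%N ->
     sigma a \in ('Gal({:L} / 1))%g /\ sigma a zeta = zeta ^+ a)
  (u : L) (u_int : int_adjoin zeta u) (u_norm : galNorm 1 {:L} u = N%:R)
  (omega : {unit 'F_p} -> padic_int p_pr) (omegaP : is_teichmuller omega)
  (chi : {unit 'F_p} -> padic_int p_pr) (chiP : padic_character chi)
  (chi_odd : unit_ext chi (-1) = -1) (chi_neq : chi <> omega)
  (B : padic_int p_pr) (BE : FracField.tofrac B = bernoulli1_inv chi)
  (B_unit : B \is a GRing.unit) :
  \sum_(2 <= a < p) padic_mod nu (char_inv chi a - 1)
     * unit_ext log (residue_class zeta N u (sigma a u))
  = padic_mod nu B^-1
     * \sum_(1 <= k < N) padic_mod nu (\sum_(1 <= a < k) char_inv chi a)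
         * unit_ext log (k%:R : 'F_N).
Proof.
case: nu nuE log logM log_surj => [|n] nuE log logM log_surj; last first.
  exact: (mainTheorem3_succ N_pr p_ge5 N_mod_p nuE logM zeta_prim zeta_gen sigmaE
            u_int u_norm chiP chi_odd BE B_unit).
(* [nu = 0] cannot occur, since [p] divides [N - 1]. *)
have : (0 < logn p (N - 1))%N.
  rewrite logn_gt0 mem_primes p_pr subn_gt0 prime_gt1 //=.
  by rewrite -eqn_mod_dvd ?prime_gt0 //; apply/eqP.
by rewrite -nuE.
Qed.
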